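(* Let $\tau:I\to I$ be piecewise monotonic and Markov, with associated local homeomorphism $\sigma:X\to X$. Let $E_1,E_2,\ldots,E_q$ be the associated Markov partition for $\sigma$, with incidence matrix $A$, and define $\psi:\mathbb Z^q\to C(X,\mathbb Z)$ by $\psi(z_1,z_2,\ldots,z_q)=\sum_i z_i\chi_{E_i}$. Then the map $\Phi:G_A\to DG(\tau)$ defined by $\Phi([v,n])=\mathcal L_*^{-n}[\psi(v)]$ is an isomorphism from the dimension triple $(G_A,G_A^+,A_* )$ onto the dimension triple $(DG(\tau),DG(\tau)^+,\mathcal L_* )$ (that is, an isomorphism of ordered groups carrying $A_*$ to $\mathcal L_*$).
   Context: Piecewise monotonic maps. Let $I=[0,1]$. A map $\tau:I\to I$ is piecewise monotonic if there are points $0=a_0<a_1<\dots<a_n=1$ such that $\tau|_{(a_{i-1},a_i)}$ is continuous and strictly monotonic for $1\le i\le n$. $C=\{a_0,\dots,a_n\}$ is the partition associated with $\tau$; it is maximal if the intervals $(a_{i-1},a_i)$ are the largest open intervals on which $\tau$ is continuous and strictly monotonic. $\widehat\tau(x)$ denotes the set of left and right limits of $\tau$ at $x$ (identified with $\tau(x)$ where $\tau$ is continuous), $\widehat\tau(A)=\bigcup_{x\in A}\widehat\tau(x)$ and $\widehat\tau^{-1}(A)=\{x\in I\mid \widehat\tau(x)\cap A\ne\emptyset\}$. The generalized orbit $I_1$ of $C$ is the smallest subset of $I$ containing $C$ and closed under $\widehat\tau$ and $\widehat\tau^{-1}$; $I_0=I\setminus I_1$. Associated local homeomorphism. The disconnection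 $X$ of $I$ at points of $I_1$ is the totally ordered set obtained from $I$ by replacing each $x\in I_1\setminus\{0,1\}$ by two points $x^-<x^+$, with the order topology (it is homeomorphic to a compact subset of $\mathbb R$); $\pi:X\to I$ is the collapse map, $\pi(x^\pm)=x$ and $\pi(x)=x$ for $x\in I_0$. For any $x\in I$, $x^-$ and $x^+$ denote the smallest and largest points of $\pi^{-1}(x)$ (equal if $x\in I_0\cup\{0,1\}$). For $a,b\in X$, $[a,b]_X=\{x\in X\mid a\le x\le b\}$. With $X_0=\pi^{-1}(I_0)$, the local homeomorphism associated with $\tau$ is the unique continuous map $\sigma:X\to X$ with $\pi\circ\sigma=\tau\circ\pi$ on $X_0$. Dimension group. The transfer map $\mathcal L:C(X,\mathbb Z)\to C(X,\mathbb Z)$ is $(\mathcal Lf)(x)=\sum_{\sigma(y)=x}f(y)$. For $f,g\in C(X,\mathbb Z)$ put $f\sim g$ if $\mathcal L^nf=\mathcal L^ng$ for some $n\ge0$. $DG(\tau)=G_\sigma$ is the group of equivalence classes $[f]$, with $[f]+[g]=[f+g]$ and positive cone $DG(\tau)^+=\{[f]\mid f\ge 0\}$; $\mathcal L_*[f]=[\mathcal Lf]$. In the notation $DG(\tau)$ the partition $C$ is taken to be the maximal one. (For Markov $\tau$, $\mathcal L_*$ is an automorphism of $DG(\tau)$.) Markov maps. $\tau$ is Markov if there is a partition $0=b_0<b_1<\dots<b_q=1$ with each $b_i\in I_1$ (a Markov partition for $\tau$) such that for each $i$, $\tau$ is monotonic on $(b_{i-1},b_i)$, $\overline{\tau((b_{i-1},b_i))}$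 is a union of intervals of the form $[b_{j-1},b_j]$, and for some $k\ge0$, $\widehat\tau^k(C)\subset\{b_0,\dots,b_q\}$. The associated Markov partition for $\sigma$ is the partition of $X$ into the clopen order intervals $E_i=[b_{i-1}^+,b_i^-]_X$, $1\le i\le q$; $\sigma$ is monotonic on each $E_i$ and maps it onto a union of some of the $E_j$. The incidence matrix is the $q\times q$ zero-one matrix with $A_{ij}=1$ iff $\sigma(E_i)\supset E_j$. The group $G_A$. For a $q\times q$ zero-one matrix $A$, $G_A$ is the stationary inductive limit of $\mathbb Z^q\xrightarrow{A}\mathbb Z^q\xrightarrow{A}\cdots$ in the category of ordered abelian groups, $A$ acting by right multiplication on row vectors. $[v,n]$ denotes the element of $G_A$ represented by $v$ in the $n$-th copy of $\mathbb Z^q$; so $[v,n]=[w,m]$ iff $vA^{m+k}=wA^{n+k}$ for some $k\ge0$, and $[v,n]\in G_A^+$ iff $vA^k\ge0$ for some $k\ge0$. $A_*$ is the automorphism $A_*[v,n]=[vA,n]$. *)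

(* Defs.v *)
From HB Require Import structures.
From mathcomp Require Import all_boot all_order all_algebra.
From mathcomp Require Import all_classical all_reals all_analysis.
From mathcomp Require Import finmap zify.
Import numFieldNormedType.Exports.

Set Implicit Arguments.
Unset Strict Implicit.
Unset Printing Implicit Defensive.

Import Order.TTheory GRing.Theory Num.Theory.

Local Open Scope classical_set_scope.
Local Open Scope ring_scope.
Local Open Scope quotient_scope.

(* ------------------------------------------------------------------------- *)
(* A map I -> I is a function tau : R -> R that maps I into I; its values    *)
(* outside I are never used. A partition 0 = a_0 < ... < a_n = 1 is given by *)
(* n and a : nat -> R; the values a k for k > n are never used.              *)
(* ------------------------------------------------------------------------- *)

Section PiecewiseMonotonic.
Context {R : realType}.
Implicit Types (tau : R -> R) (a b : nat -> R) (n q : nat) (A C : set R).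

Definition unitI : set R := `[0, 1]%classic.

Definition is_partition n a : Prop :=
  [/\ a 0%N = 0, a n = 1 & forall i, (i < n)%N -> a i < a i.+1].

Definition partition_points n a : set R := a @` `I_n.+1.

Definition cont_strict_mono tau (c d : R) : Prop :=
  {in `]c, d[, continuous tau} /\
  ({in `]c, d[ &, {homo tau : x y / x < y}} \/
   {in `]c, d[ &, {homo tau : x y /~ x < y}}).

Definition piecewise_monotonic tau n a : Prop :=
  [/\ {homo tau : x / unitI x},
      is_partition n a
    & forall i, (i < n)%N -> cont_strict_mono tau (a i) (a i.+1)].

Definition maximal_partition tau n a : Prop :=
  forall i, (i < n)%N -> forall c d : R,
    0 <= c -> d <= 1 -> cont_strict_mono tau c d ->
    `]a i, a i.+1[ `<=` `]c, d[ -> `]c, d[%classic = `]a i, a i.+1[%classic.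

(* At 0 (resp. 1) only the right (resp. left) limit makes sense on I. *)
Definition lim_set tau (x : R) : set R :=
  [set y | (0 < x <= 1 /\ tau z @[z --> x^'-] --> y) \/
           (0 <= x < 1 /\ tau z @[z --> x^'+] --> y)].

Definition lim_image tau A : set R := \bigcup_(x in A) lim_set tau x.

Definition lim_preimage tau A : set R :=
  [set x | unitI x /\ lim_set tau x `&` A !=set0].

Definition gen_orbit tau C : set R :=
  smallest [set A | [/\ A `<=` unitI, lim_image tau A `<=` A
                      & lim_preimage tau A `<=` A]] C.

Definition markov_partition tau C q b : Prop :=
  [/\ is_partition q b,
      (forall i, (i <= q)%N -> gen_orbit tau C (b i)),
      (forall i, (i < q)%N ->
         {in `]b i, b i.+1[ &, {homo tau : x y / x <= y}} \/
         {in `]b i, b i.+1[ &, {homo tau : x y /~ x <= y}}),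
      (forall i, (i < q)%N -> exists J : set 'I_q,
         closure (tau @` `]b i, b i.+1[) = \bigcup_(j in J) `[b j, b j.+1]%classic)
    & exists k, iter k (lim_image tau) C `<=` partition_points q b].

End PiecewiseMonotonic.

(* ------------------------------------------------------------------------- *)
(* A point of the disconnection is a pair (t, e) with t in I, ordered        *)
(* lexicographically. If t \in D \ {0, 1} both (t, false) = t^- and          *)
(* (t, true) = t^+ are points; otherwise (t, false) is the only point over t.*)
(* ------------------------------------------------------------------------- *)

Section Disconnection.
Context {R : realType}.
Variable D : set R.

Definition disc_pred (p : R *l bool) : bool :=
  (0 <= p.1 <= 1) && (p.2 ==> `[< D p.1 >] && (0 < p.1 < 1)).

Definition disc_sub : Type := {p : R *l bool | disc_pred p}.
HB.instance Definition _ := SubChoice.on disc_sub.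
HB.instance Definition _ :=
  [SubChoice_isSubOrder of disc_sub by <: with Order.default_display].

Definition disconnection : Type := order_topology disc_sub.
HB.instance Definition _ := OrderTopological.on disconnection.
HB.instance Definition _ := SubChoice.on disconnection.

Definition collapse (x : disconnection) : R := (val x).1.

Lemma disc_pred0 : disc_pred (0, false).
Proof. by rewrite /disc_pred /= lexx ler01. Qed.

(* t^- and t^+, for t in I; outside I both are the junk value 0. *)
Definition xminus (t : R) : disconnection :=
  insubd (Sub (0, false) disc_pred0 : disconnection) (t, false).
Definition xplus (t : R) : disconnection := insubd (xminus t) (t, true).

End Disconnection.

Definition associated_map {R : realType} (tau : R -> R) (I1 : set R)
    (sigma : disconnection I1 -> disconnection I1) : Prop :=
  continuous sigma /\
  forall x, ~ I1 (collapse x) -> collapse (sigma x) = tau (collapse x).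

HB.instance Definition _ := hasNbhs.Build int principal_filter.
HB.instance Definition _ := Discrete_ofNbhs.Build int erefl.

Definition CZ (X : topologicalType) : Type := continuousType X int.

Section ContinuousIntegerFunctions.
Context {X : topologicalType}.

HB.instance Definition _ := Choice.on (CZ X).

Definition CZ_fun (f : CZ X) : X -> int := f.
Coercion CZ_fun : CZ >-> Funclass.

Lemma CZ_fun_inj : injective CZ_fun.
Proof. by move=> f g fg; apply/continuousEP => x; rewrite -/(CZ_fun f x) fg. Qed.

Lemma CZ_locally_cst (f : CZ X) x : \forall y \near x, f y = f x.
Proof.
have /discrete_cvg : f @ x --> f x by exact: cts_fun.
exact.
Qed.

Lemma locally_cst_continuous (f : X -> int) :
  (forall x, \forall y \near x, f y = f x) -> continuous f.
Proof. by move=> fc x; apply/discrete_cvg; exact: fc. Qed.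

Definition mkCZ (f : X -> int) (fc : continuous f) : CZ X :=
  HB.pack_for (continuousType X int) f (isContinuous.Build X int f fc).

Lemma CZ0_subproof : continuous (fun _ : X => 0 : int).
Proof. by apply: locally_cst_continuous => x; exact: nearW. Qed.

Lemma CZN_subproof (f : CZ X) : continuous (fun x => - f x).
Proof.
apply: locally_cst_continuous => x.
by move: (@CZ_locally_cst f x); apply: filterS => y ->.
Qed.

Lemma CZD_subproof (f g : CZ X) : continuous (fun x => f x + g x).
Proof.
apply: locally_cst_continuous => x.
by move: (@CZ_locally_cst f x) (@CZ_locally_cst g x); apply: filterS2 => y -> ->.
Qed.

Definition CZ0 : CZ X := mkCZ CZ0_subproof.
Definition CZN (f : CZ X) : CZ X := mkCZ (@CZN_subproof f).
Definition CZD (f g : CZ X) : CZ X := mkCZ (@CZD_subproof f g).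

Lemma CZDA : associative CZD.
Proof. by move=> f g h; apply/CZ_fun_inj/funext => x; exact: addrA. Qed.
Lemma CZDC : commutative CZD.
Proof. by move=> f g; apply/CZ_fun_inj/funext => x; exact: addrC. Qed.
Lemma CZ0D : left_id CZ0 CZD.
Proof. by move=> f; apply/CZ_fun_inj/funext => x; exact: add0r. Qed.
Lemma CZND : left_inverse CZ0 CZN CZD.
Proof. by move=> f; apply/CZ_fun_inj/funext => x; exact: addNr. Qed.

HB.instance Definition _ := GRing.isZmodule.Build (CZ X) CZDA CZDC CZ0D CZND.

Lemma CZ_addE (f g : CZ X) : CZ_fun (f + g) = fun x => f x + g x.
Proof. by []. Qed.
Lemma CZ_oppE (f : CZ X) : CZ_fun (- f) = fun x => - f x.
Proof. by []. Qed.

End ContinuousIntegerFunctions.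

Section DimensionGroup.
Context {X : topologicalType}.
Variable sigma : X -> X.

(* fset_set of an infinite set is empty, so an infinite fibre would          *)
(* contribute 0; the maps considered below have finite fibres.               *)
Definition transfer (f : X -> int) : X -> int :=
  fun x => \sum_(y <- fset_set (sigma @^-1` [set x])) f y.

Definition dg_equiv (f g : CZ X) : bool :=
  `[< exists n, iter n transfer f = iter n transfer g >].

Lemma dg_equiv_class : equiv_class_of dg_equiv.
Proof.
split=> [f|f g|g f h].
- by apply/asboolP; exists 0%N.
- by apply/asboolP/asboolP => -[n fg]; exists n.
- move=> /asboolP[n fg] /asboolP[m gh]; apply/asboolP; exists (m + n)%N.
  by rewrite iterD fg -iterD addnC iterD gh -iterD addnC.
Qed.

Canonical dg_equiv_equiv := EquivRelPack dg_equiv_class.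
Canonical dg_equiv_encModRel := defaultEncModRel dg_equiv.

Definition DG : Type := {eq_quot dg_equiv}.
HB.instance Definition _ := EqQuotient.on DG.
HB.instance Definition _ := Choice.on DG.

Definition dg_class (f : CZ X) : DG := \pi f.

Lemma dg_classP f g :
  dg_class f = dg_class g <-> exists n, iter n transfer f = iter n transfer g.
Proof.
split=> [/eqP|fg]; first by rewrite /dg_class piE => /asboolP.
by apply/eqP; rewrite /dg_class piE; apply/asboolP.
Qed.

Lemma iter_transferD n (f g : X -> int) :
  iter n transfer (fun x => f x + g x) =
  fun x => iter n transfer f x + iter n transfer g x.
Proof.
by elim: n => //= n ->; apply/funext => x; rewrite /transfer big_split.
Qed.

Lemma iter_transferN n (f : X -> int) :
  iter n transfer (fun x => - f x) = fun x => - iter n transfer f x.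
Proof. by elim: n => //= n ->; apply/funext => x; rewrite /transfer sumrN. Qed.

Lemma iter_transfer_ge n m (f g : X -> int) : (n <= m)%N ->
  iter n transfer f = iter n transfer g -> iter m transfer f = iter m transfer g.
Proof. by move=> /subnK <- fg; rewrite !iterD fg. Qed.

Definition dg_zero : DG := lift_cst DG 0.
Definition dg_opp := lift_op1 DG -%R.
Definition dg_add := lift_op2 DG +%R.

Canonical pi_dg_zero := PiConst dg_zero.

Lemma pi_dg_oppM : {morph \pi_DG : f / - f >-> dg_opp f}.
Proof.
move=> f; unlock dg_opp; apply/dg_classP.
have /dg_classP[n e] : dg_class f = dg_class (repr (\pi_DG f)).
  by rewrite /dg_class reprK.
by exists n; rewrite !CZ_oppE !iter_transferN e.
Qed.
Canonical pi_dg_opp := PiMorph1 pi_dg_oppM.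

Lemma pi_dg_addM : {morph \pi_DG : f g / f + g >-> dg_add f g}.
Proof.
move=> f g; unlock dg_add; apply/dg_classP.
have /dg_classP[n e] : dg_class f = dg_class (repr (\pi_DG f)).
  by rewrite /dg_class reprK.
have /dg_classP[m h] : dg_class g = dg_class (repr (\pi_DG g)).
  by rewrite /dg_class reprK.
exists (maxn n m); rewrite !CZ_addE !iter_transferD.
by rewrite (iter_transfer_ge (leq_maxl n m) e) (iter_transfer_ge (leq_maxr n m) h).
Qed.
Canonical pi_dg_add := PiMorph2 pi_dg_addM.

Lemma dg_addA : associative dg_add.
Proof. by move=> x y z; rewrite -[x]reprK -[y]reprK -[z]reprK !piE addrA. Qed.
Lemma dg_addC : commutative dg_add.
Proof. by move=> x y; rewrite -[x]reprK -[y]reprK !piE addrC. Qed.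
Lemma dg_add0 : left_id dg_zero dg_add.
Proof. by move=> x; rewrite -[x]reprK !piE add0r. Qed.
Lemma dg_addN : left_inverse dg_zero dg_opp dg_add.
Proof. by move=> x; rewrite -[x]reprK !piE addNr. Qed.

HB.instance Definition _ :=
  GRing.isZmodule.Build DG dg_addA dg_addC dg_add0 dg_addN.

Lemma dg_classD : {morph dg_class : f g / f + g}.
Proof. exact: pi_dg_addM. Qed.

Definition DG_pos : set DG :=
  [set x | exists f : CZ X, (forall y, 0 <= f y) /\ x = dg_class f].

(* Contains the fact that the transfer map sends C(X, Z) to itself. *)
Definition is_transfer_star (Lstar : DG -> DG) : Prop :=
  forall f : CZ X, exists g : CZ X,
    CZ_fun g = transfer f /\ Lstar (dg_class f) = dg_class g.

End DimensionGroup.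

Section InductiveLimit.
Context {q : nat}.
Variable A : 'M[int]_q.

Definition ga_pre : Type := 'rV[int]_q * nat.
HB.instance Definition _ := Choice.on ga_pre.
Implicit Types x y z : ga_pre.

Definition ga_equiv x y : bool :=
  `[< exists k, x.1 *m A ^+ (y.2 + k) = y.1 *m A ^+ (x.2 + k) >].

Let mulXD (v : 'rV[int]_q) m n : v *m A ^+ (m + n) = v *m A ^+ m *m A ^+ n.
Proof. by rewrite exprD -mulmxA. Qed.

Lemma ga_equiv_class : equiv_class_of ga_equiv.
Proof.
split=> [x|x y|y x z].
- by apply/asboolP; exists 0%N.
- by apply/asboolP/asboolP => -[k e]; exists k.
- move=> /asboolP[k xy] /asboolP[l yz]; apply/asboolP.
  exists (y.2 + (k + l))%N.
  have -> : (z.2 + (y.2 + (k + l)) = (y.2 + k) + (z.2 + l))%N by lia.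
  rewrite mulXD xy -mulXD addnC mulXD yz -mulXD.
  by congr (_ *m A ^+ _); lia.
Qed.

Canonical ga_equiv_equiv := EquivRelPack ga_equiv_class.
Canonical ga_equiv_encModRel := defaultEncModRel ga_equiv.

Definition GA : Type := {eq_quot ga_equiv}.
HB.instance Definition _ := EqQuotient.on GA.
HB.instance Definition _ := Choice.on GA.

Definition ga_class (v : 'rV[int]_q) (n : nat) : GA := \pi_GA ((v, n) : ga_pre).

Lemma ga_classP v n w m :
  ga_class v n = ga_class w m <->
  exists k, v *m A ^+ (m + k) = w *m A ^+ (n + k).
Proof.
split=> [/eqP|e]; first by rewrite /ga_class piE => /asboolP.
by apply/eqP; rewrite /ga_class piE; apply/asboolP.
Qed.

Lemma ga_classE x : \pi_GA x = ga_class x.1 x.2.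
Proof. by case: x. Qed.

Let ga0 : ga_pre := (0, 0%N).
Let gaN x : ga_pre := (- x.1, x.2).
Let gaD x y : ga_pre := (x.1 *m A ^+ y.2 + y.1 *m A ^+ x.2, (x.2 + y.2)%N).

Let ga_reprP x : exists k,
  x.1 *m A ^+ ((repr (\pi_GA x)).2 + k) = (repr (\pi_GA x)).1 *m A ^+ (x.2 + k).
Proof. by apply/ga_classP; rewrite -!ga_classE reprK. Qed.

Definition ga_zero : GA := lift_cst GA ga0.
Definition ga_opp := lift_op1 GA gaN.
Definition ga_add := lift_op2 GA gaD.

Canonical pi_ga_zero := PiConst ga_zero.

Lemma pi_ga_oppM : {morph \pi_GA : x / gaN x >-> ga_opp x}.
Proof.
move=> x; unlock ga_opp; rewrite [LHS]ga_classE [RHS]ga_classE; apply/ga_classP => /=.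
by have [k e] := ga_reprP x; exists k; rewrite !mulNmx e.
Qed.
Canonical pi_ga_opp := PiMorph1 pi_ga_oppM.

Lemma pi_ga_addM : {morph \pi_GA : x y / gaD x y >-> ga_add x y}.
Proof.
move=> x y; unlock ga_add; rewrite [LHS]ga_classE [RHS]ga_classE; apply/ga_classP => /=.
have [k] := ga_reprP x; have [l] := ga_reprP y.
set x' := repr (\pi_GA x); set y' := repr (\pi_GA y) => ey ex.
exists (k + l)%N; rewrite !mulmxDl -!mulXD; congr (_ + _).
  have -> : (y.2 + (x'.2 + y'.2 + (k + l)) = (x'.2 + k) + (y.2 + y'.2 + l))%N.
    by lia.
  by rewrite mulXD ex -mulXD; congr (_ *m A ^+ _); lia.
have -> : (x.2 + (x'.2 + y'.2 + (k + l)) = (y'.2 + l) + (x.2 + x'.2 + k))%N.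
  by lia.
by rewrite mulXD ey -mulXD; congr (_ *m A ^+ _); lia.
Qed.
Canonical pi_ga_add := PiMorph2 pi_ga_addM.

Lemma ga_addA : associative ga_add.
Proof.
move=> x y z; rewrite -[x]reprK -[y]reprK -[z]reprK !piE !ga_classE.
apply/ga_classP; exists 0%N => /=; rewrite !mulmxDl -!mulXD !addrA.
by congr (_ + _ + _); congr (_ *m A ^+ _); lia.
Qed.

Lemma ga_addC : commutative ga_add.
Proof.
move=> x y; rewrite -[x]reprK -[y]reprK !piE !ga_classE.
by apply/ga_classP; exists 0%N; congr (_ *m A ^+ _); [exact: addrC|rewrite /=; lia].
Qed.

Lemma ga_add0 : left_id ga_zero ga_add.
Proof.
move=> x; rewrite -[x]reprK !piE !ga_classE.
by apply/ga_classP; exists 0%N => /=; rewrite mul0mx add0r expr0 mulmx1.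
Qed.

Lemma ga_addN : left_inverse ga_zero ga_opp ga_add.
Proof.
move=> x; rewrite -[x]reprK !piE !ga_classE.
by apply/ga_classP; exists 0%N => /=; rewrite mulNmx addNr !mul0mx.
Qed.

HB.instance Definition _ :=
  GRing.isZmodule.Build GA ga_addA ga_addC ga_add0 ga_addN.

Lemma ga_classD v n w m :
  ga_class v n + ga_class w m = ga_class (v *m A ^+ m + w *m A ^+ n) (n + m).
Proof. exact: esym (pi_ga_addM (v, n) (w, m)). Qed.

Definition GA_pos : set GA :=
  [set x | exists v n, x = ga_class v n /\
     exists k, forall i, 0 <= (v *m A ^+ k) 0 i].

Definition ga_shift (x : GA) : GA := ga_class ((repr x).1 *m A) (repr x).2.

Lemma ga_shiftE v n : ga_shift (ga_class v n) = ga_class (v *m A) n.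
Proof.
have [k] := ga_reprP (v, n); rewrite /ga_shift /ga_class /=.
set y := repr _ => e; apply/ga_classP; exists k.
have mulAX (w : 'rV[int]_q) m : w *m A *m A ^+ m = w *m A ^+ m *m A.
  by rewrite -!mulmxA -[A *m _]exprS -[_ *m A]exprSr.
by rewrite !mulAX e.
Qed.

End InductiveLimit.

Section MarkovPartition.
Context {R : realType}.

(* Pieces are indexed from 0: markov_piece b i = [b_i^+, b_(i+1)^-]_X.       *)
Definition markov_piece {D : set R} (b : nat -> R) (i : nat) :
    set (disconnection D) :=
  `[xplus D (b i), xminus D (b i.+1)]%classic.

Definition incidence {D : set R} (sigma : disconnection D -> disconnection D)
    (q : nat) (b : nat -> R) : 'M[int]_q :=
  \matrix_(i, j) (`[< markov_piece b j `<=` sigma @` markov_piece b i >])%:R.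

Definition psi_fun {D : set R} (q : nat) (b : nat -> R) (v : 'rV[int]_q) :
    disconnection D -> int :=
  fun x => \sum_(i < q) v 0 i * \1_(markov_piece b i) x.

Section PiecesAreClopen.
Variable D : set R.
Local Notation X := (disconnection D).
Implicit Types (x y : X) (t : R).

Lemma disc_leE x y : (x <= y)%O =
  (collapse x <= collapse y) &&
  ((collapse y <= collapse x) ==> ((val x).2 <= (val y).2)%O).
Proof. by []. Qed.

Lemma collapse_itv x : 0 <= collapse x <= 1.
Proof. by have /andP[] := valP x. Qed.

Lemma collapse_true x : (val x).2 -> D (collapse x) /\ 0 < collapse x < 1.
Proof.
by have /andP[_ /implyP h] := valP x => /h /andP[/asboolP].
Qed.

Lemma val_xminus t : 0 <= t <= 1 -> val (xminus D t) = (t, false).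
Proof.
by move=> t01; rewrite /xminus insubdK // unfold_in /disc_pred /= t01.
Qed.

Lemma val_xplus t : D t -> 0 < t < 1 -> val (xplus D t) = (t, true).
Proof.
move=> Dt /andP[t0 t1]; rewrite /xplus insubdK // unfold_in /disc_pred /=.
by rewrite !ltW //= t0 t1 !andbT; apply/asboolP.
Qed.

Lemma xplus_xminus t : ~ 0 < t < 1 -> xplus D t = xminus D t.
Proof.
move=> nt; rewrite /xplus /insubd insubN //; apply/negP.
by case/andP=> _ /andP[].
Qed.

Lemma lt_xplus t x : D t -> 0 < t < 1 ->
  (x < xplus D t)%O = (x <= xminus D t)%O.
Proof.
move=> Dt t01; have t01' : 0 <= t <= 1 by case/andP: t01 => /ltW -> /ltW.
rewrite ltNge !disc_leE /collapse val_xplus // val_xminus //=.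
by case: ((val x).2); case: (ltgtP t (val x).1).
Qed.

Lemma gt_xminus t x : D t -> 0 < t < 1 ->
  (xminus D t < x)%O = (xplus D t <= x)%O.
Proof. by move=> Dt t01; rewrite ltNge -lt_xplus // -leNgt. Qed.

Lemma open_ge_xplus t : D t -> 0 <= t < 1 -> open `[xplus D t, +oo[%classic.
Proof.
move=> Dt /andP[]; rewrite le_eqVlt => /predU1P[<- _|t0 t1].
  rewrite (_ : mkset _ = setT); first exact: openT.
  apply/seteqP; split => // x _ /=; rewrite in_itv /= andbT.
  rewrite xplus_xminus ?ltxx // disc_leE /collapse val_xminus ?lexx ?ler01 //=.
  by case/andP: (collapse_itv x) => -> _; case: ((val x).2); rewrite /= ?implybT.
rewrite (_ : mkset _ = `]xminus D t, +oo[%classic); first exact: rray_open.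
by apply/seteqP; split => x /=; rewrite !in_itv /= !andbT gt_xminus ?t0.
Qed.

Lemma open_le_xminus t : D t -> 0 < t <= 1 -> open `]-oo, xminus D t]%classic.
Proof.
move=> Dt /andP[t0]; rewrite le_eqVlt => /predU1P[t1|t1].
  rewrite (_ : mkset _ = setT); first exact: openT.
  apply/seteqP; split => // x _ /=; rewrite in_itv /=.
  have /andP[x0 x1] := collapse_itv x.
  rewrite disc_leE /collapse val_xminus t1 ?lexx ?ler01 //= x1 /=.
  case b : ((val x).2); rewrite ?implybT //=.
  by have [_ /andP[_ xl]] := collapse_true b; rewrite leNgt xl.
rewrite (_ : mkset _ = `]-oo, xplus D t[%classic); first exact: lray_open.
by apply/seteqP; split => x /=; rewrite !in_itv /= lt_xplus ?t0.
Qed.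

Lemma open_piece (s t : R) : D s -> D t -> 0 <= s < 1 -> 0 < t <= 1 ->
  open `[xplus D s, xminus D t]%classic.
Proof.
move=> Ds Dt s01 t01; rewrite set_itv_splitI /=.
by apply: openI; [exact: open_ge_xplus|exact: open_le_xminus].
Qed.

Lemma closed_piece (s t : R) : closed `[xplus D s, xminus D t]%classic.
Proof. exact: itv_closed. Qed.

End PiecesAreClopen.

Lemma partition_bounds q (b : nat -> R) : is_partition q b ->
  forall i, (i < q)%N -> 0 <= b i < 1 /\ 0 < b i.+1 <= 1.
Proof.
move=> [b0 bq bS].
have mono i j : (i <= j)%N -> (j <= q)%N -> b i <= b j.
  move=> ij; elim: j ij => [|j IH]; first by rewrite leqn0 => /eqP ->.
  rewrite leq_eqVlt => /predU1P[-> //|ij jq].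
  exact: le_trans (IH ij (ltnW jq)) (ltW (bS _ jq)).
move=> i iq; rewrite -b0 -bq !mono ?(ltnW iq) //=; split.
  exact: lt_le_trans (bS i iq) (mono _ _ iq (leqnn q)).
by rewrite andbT; exact: le_lt_trans (mono 0%N i _ (ltnW iq)) (bS i iq).
Qed.

Lemma psi_continuous (tau : R -> R) (C : set R) q b
    (bM : markov_partition tau C q b) (v : 'rV[int]_q) :
  continuous (psi_fun b v : disconnection (gen_orbit tau C) -> int).
Proof.
apply: locally_cst_continuous => x.
have near_piece (i : 'I_q) : \forall y \near x,
    \1_(markov_piece b i) y = \1_(markov_piece b i) x :> int.
  have [bP bI1 _ _ _] := bM.
  have [bi bi1] := partition_bounds bP (ltn_ord i).
  have oP : open (markov_piece b i : set (disconnection (gen_orbit tau C))).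
    by apply: open_piece => //; apply: bI1 => //; exact: ltnW.
  have cP : closed (markov_piece b i : set (disconnection (gen_orbit tau C))).
    exact: closed_piece.
  have [Px|nPx] := pselect (markov_piece b i x).
    have := open_nbhs_nbhs (conj oP Px); apply: filterS => y Py.
    by rewrite !indicE !mem_set.
  have := open_nbhs_nbhs (conj (closed_openC cP) nPx); apply: filterS => y nPy.
  by rewrite !indicE !memNset.
have near_all : \forall y \near x, forall i : 'I_q,
    \1_(markov_piece b i) y = \1_(markov_piece b i) x :> int.
  exact: filter_forall near_piece.
move: near_all; apply: filterS => y e.
by apply: eq_bigr => i _; rewrite e.
Qed.

Definition psi (tau : R -> R) (C : set R) q b
    (bM : markov_partition tau C q b) (v : 'rV[int]_q) :
    CZ (disconnection (gen_orbit tau C)) :=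
  mkCZ (@psi_continuous _ _ _ _ bM v).

End MarkovPartition.

Arguments dg_class {X} sigma f.
Arguments DG_pos {X sigma}.
Arguments ga_class {q} A v n.
Arguments GA_pos {q A}.
Arguments ga_shift {q A} x.

(* Main.v *)
Require Import Defs.
From HB Require Import structures.
From mathcomp Require Import all_boot all_order all_algebra.
From mathcomp Require Import all_classical all_reals all_analysis.
From mathcomp Require Import zify lra.
Import numFieldNormedType.Exports.
Import Order.TTheory GRing.Theory Num.Theory.
Set Implicit Arguments.
Unset Strict Implicit.
Unset Printing Implicit Defensive.
Local Open Scope classical_set_scope.
Local Open Scope ring_scope.

(* A function f in C(X, Z) jumps at only finitely many cuts t^- < t^+, t in I1.
   On each piece E_i the map sigma is injective and monotone, and it carries
   cuts to cuts, so L f jumps only at one-sided images of the jumps of f and at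
   Markov points. Every point of I1 eventually lands in the Markov partition;
   hence L f is continuous, and L^k f is constant on every E_j, i.e. of the form
   psi v, for k large. As L (psi v) = psi (v A), everything reduces to row
   vectors, except that L_* is onto: an index j in the support of v A^q ends
   paths of every length, so chi_(E_j) = L^k g for every k with some g >= 0. *)

(** * The topology of the disconnection *)

Section Disconnection.
Context {R : realType}.
Variable D : set R.
Local Notation X := (disconnection D).
Implicit Types (x y z : X) (t : R).

(** Little is known of [sigma] directly: it is continuous, and it agrees with [tau] only over points
    outside I_1. Its behaviour at cuts is therefore always obtained by approximation from X_0. This
    works because I_1 is countable, hence has dense complement: I_1 is exhausted by the sets
    [landing k], each finite inside [0,1]. The same sets measure how many transfers are needed
    before the jumps of a function sit at Markov points. The obstacle to surjectivity of L_* is that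
    [sigma] need not be onto: the indicator of a piece outside its image is not in the range of L,
    and only its class can be. Hence the detour through indices with an infinite past. Preimages are
    kept nonnegative throughout, because Phi involves negative powers of L_* and must still preserve
    positive classes. *)

Lemma xplusN t : ~ (D t /\ 0 < t < 1) -> xplus D t = xminus D t.
Proof.
move=> nt; rewrite /xplus /insubd insubN //; apply/negP.
by rewrite /disc_pred /= => /andP[_ /andP[/asboolP Dt t01]]; apply: nt.
Qed.

Lemma collapse_xminus t : 0 <= t <= 1 -> collapse (xminus D t) = t.
Proof. by move=> t01; rewrite /collapse val_xminus. Qed.

Lemma collapse_xplus t : 0 <= t <= 1 -> collapse (xplus D t) = t.
Proof.
move=> t01; have [[Dt t01']|nt] := pselect (D t /\ 0 < t < 1).
  by rewrite /collapse val_xplus.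
by rewrite xplusN // collapse_xminus.
Qed.

Lemma le_collapse x y : (x <= y)%O -> collapse x <= collapse y.
Proof. by rewrite disc_leE => /andP[]. Qed.

Lemma collapse_lt x y : collapse x < collapse y -> (x < y)%O.
Proof. by move=> xy; rewrite ltNge disc_leE negb_and -ltNge xy. Qed.

Lemma xminus_or_xplus x :
  x = xminus D (collapse x) \/ x = xplus D (collapse x).
Proof.
have x01 := collapse_itv x; case b : ((val x).2).
  have [Dx x01'] := collapse_true b; right; apply: val_inj.
  by rewrite val_xplus // [LHS]surjective_pairing b.
left; apply: val_inj; by rewrite val_xminus // [LHS]surjective_pairing b.
Qed.

Lemma xminus_le_xplus t : 0 <= t <= 1 -> (xminus D t <= xplus D t)%O.
Proof.
move=> t01; have [[Dt t01']|nt] := pselect (D t /\ 0 < t < 1).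
  by apply: ltW; rewrite lt_xplus.
by rewrite xplusN.
Qed.

Lemma xminus_lt_xplus t : D t -> 0 < t < 1 -> (xminus D t < xplus D t)%O.
Proof. by move=> Dt t01; rewrite lt_xplus. Qed.

Lemma xminus_le x : (xminus D (collapse x) <= x)%O.
Proof.
have [e|e] := xminus_or_xplus x; first by rewrite -e.
rewrite [X in (_ <= X)%O]e.
exact/xminus_le_xplus/collapse_itv.
Qed.

Lemma le_xplus x : (x <= xplus D (collapse x))%O.
Proof.
have [e|e] := xminus_or_xplus x; last by rewrite -e.
rewrite [X in (X <= _)%O]e.
exact/xminus_le_xplus/collapse_itv.
Qed.

(** Nothing lies strictly between t^- and t^+, which coincide when t is not split. This dichotomy
    drives all later arguments about cuts. *)
Lemma le_xminusVge_xplus t z : 0 <= t <= 1 ->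
  (z <= xminus D t)%O \/ (xplus D t <= z)%O.
Proof.
move=> t01; case: (ltgtP (collapse z) t) => [zt|tz|<-].
- by left; apply: ltW; apply: collapse_lt; rewrite collapse_xminus.
- by right; apply: ltW; apply: collapse_lt; rewrite collapse_xplus.
- by have [e|e] := xminus_or_xplus z; [left|right]; rewrite -e.
Qed.

Lemma open_collapse_gt t : open [set x : X | t < collapse x].
Proof.
have [t0|t0] := ltP t 0.
  rewrite (_ : mkset _ = setT); first exact: openT.
  apply/seteqP; split=> // x _ /=.
  by case/andP: (collapse_itv x) => x0 _; exact: lt_le_trans x0.
have [t1|t1] := ltP 1 t.
  rewrite (_ : mkset _ = set0); first exact: open0.
  apply/seteqP; split=> // x /= tx.
  case/andP: (collapse_itv x) => _ x1.
  by have := lt_trans t1 (lt_le_trans tx x1); rewrite ltxx.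
rewrite (_ : mkset _ = `]xplus D t, +oo[%classic); first exact: rray_open.
apply/seteqP; split=> x /=; rewrite in_itv /= andbT => tx.
  by apply: collapse_lt; rewrite collapse_xplus // t0 t1.
rewrite ltNge; apply/negP => xt; move: tx; apply/negP; rewrite -leNgt.
apply: le_trans (le_xplus x) _.
move: xt; rewrite le_eqVlt => /predU1P[->//|xt].
apply: ltW; apply: collapse_lt; rewrite !collapse_xplus ?t0 ?t1 //.
exact: collapse_itv.
Qed.

Lemma open_collapse_lt t : open [set x : X | collapse x < t].
Proof.
have [t0|t0] := ltP t 0.
  rewrite (_ : mkset _ = set0); first exact: open0.
  apply/seteqP; split=> // x /= tx.
  case/andP: (collapse_itv x) => x0 _.
  by have := lt_trans tx (lt_le_trans t0 x0); rewrite ltxx.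
have [t1|t1] := ltP 1 t.
  rewrite (_ : mkset _ = setT); first exact: openT.
  apply/seteqP; split=> // x _ /=.
  by case/andP: (collapse_itv x) => _ x1; exact: le_lt_trans x1 _.
rewrite (_ : mkset _ = `]-oo, xminus D t[%classic); first exact: lray_open.
apply/seteqP; split=> x /=; rewrite in_itv /= => tx.
  by apply: collapse_lt; rewrite collapse_xminus // t0 t1.
rewrite ltNge; apply/negP => xt; move: tx; apply/negP; rewrite -leNgt.
apply: le_trans (xminus_le x).
move: xt; rewrite le_eqVlt => /predU1P[<-//|xt].
apply: ltW; apply: collapse_lt; rewrite !collapse_xminus ?t0 ?t1 //.
exact: collapse_itv.
Qed.

#[global] Instance disc_nbhs_filter x : ProperFilter (nbhs x).
Proof. exact: nbhs_pfilter. Qed.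

Lemma collapse_continuous : continuous (@collapse R D).
Proof.
move=> x; apply/cvgrPdist_lt => e e0.
have gt_near : \forall y \near x, collapse x - e < collapse y.
  apply: open_nbhs_nbhs; split; first exact: open_collapse_gt.
  by rewrite /= ltrBlDr ltrDl.
have lt_near : \forall y \near x, collapse y < collapse x + e.
  apply: open_nbhs_nbhs; split; first exact: open_collapse_lt.
  by rewrite /= ltrDl.
move: gt_near lt_near; apply: filterS2 => y y1 y2.
by rewrite ltr_distlC y1 y2.
Qed.

(** No point over t lies below t^-, so the left end of a basic interval around t^- lies over a real
    strictly less than t; the gap is d. Together with the mirror statement at t^+ this reduces
    neighbourhoods in X to one-sided ones in R. *)
Lemma nbhs_xminus t (U : set X) : 0 <= t <= 1 -> nbhs (xminus D t) U ->
  exists2 d : R, 0 < d &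
    forall z, (z <= xminus D t)%O -> t - d < collapse z -> U z.
Proof.
move=> t01; rewrite itv_nbhsE => -[[l r] [lr_open /andP[/= hl hr]] lrU].
have hU z : (l <= BLeft z)%O -> (z <= xminus D t)%O -> U z.
  move=> lz zt; apply: lrU; rewrite /= itv_boundlr lz /=.
  by apply: le_trans hr; rewrite bnd_simp.
case: l => [[] a|bl] in lr_open hl lrU hU *.
- by case: r lr_open {hr lrU} => [[] ?|[]] // [].
- have aE : collapse a < t.
    rewrite ltNge; apply/negP => ta.
    have /le_lt_trans : (xminus D t <= a)%O.
      move: ta; rewrite le_eqVlt => /predU1P[->|ta]; first exact: xminus_le.
      by apply: ltW; apply: collapse_lt; rewrite collapse_xminus.
    by move: hl; rewrite bnd_simp => al /(_ _ al); rewrite ltxx.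
  exists (t - collapse a); first by rewrite subr_gt0.
  move=> z zt; rewrite opprB addrC subrK => az; apply: hU => //.
  by rewrite bnd_simp; exact: collapse_lt.
- by exists 1 => // z zt _; apply: hU => //; case: bl hl {lr_open lrU}.
Qed.

Lemma nbhs_xplus t (U : set X) : 0 <= t <= 1 -> nbhs (xplus D t) U ->
  exists2 d : R, 0 < d &
    forall z, (xplus D t <= z)%O -> collapse z < t + d -> U z.
Proof.
move=> t01; rewrite itv_nbhsE => -[[l r] [lr_open /andP[/= hl hr]] lrU].
have hU z : (BRight z <= r)%O -> (xplus D t <= z)%O -> U z.
  move=> zr tz; apply: lrU; rewrite /= itv_boundlr zr andbT.
  by apply: le_trans hl _; rewrite bnd_simp.
case: r => [[] a|br] in lr_open hr lrU hU *.
- have aE : t < collapse a.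
    rewrite ltNge; apply/negP => ta.
    have /lt_le_trans : (a <= xplus D t)%O.
      move: ta; rewrite (le_eqVlt (collapse a)) => /predU1P[<-|ta]; first exact: le_xplus.
      by apply: ltW; apply: collapse_lt; rewrite collapse_xplus.
    by move: hr; rewrite bnd_simp => al /(_ _ al); rewrite ltxx.
  exists (collapse a - t); first by rewrite subr_gt0.
  move=> z zt; rewrite addrC subrK => az; apply: hU => //.
  by rewrite bnd_simp; exact: collapse_lt.
- by case: l lr_open {hl lrU} => [[] ?|[]] // [].
- by exists 1 => // z zt _; apply: hU => //; case: br hr {lr_open lrU}.
Qed.

(** An ultrafilter on X collapses to a filter clustering at some t in [0,1]. Being an ultrafilter,
    it contains one of the two half lines ending at t^- and starting at t^+, and this choice decides
    which of the two points is the limit. *)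
Lemma compact_disconnection : compact [set: X].
Proof.
rewrite compact_ultra => F UF _.
have PF : ProperFilter F by exact: ultra_proper.
have [] := @segment_compact R 0 1 (@collapse R D @ F) _.
  apply: (@filterS _ F _ setT) => [x _|]; last exact: filterT.
  by rewrite /= in_itv; exact: collapse_itv.
move=> t [t01 Ft]; rewrite /= in_itv /= in t01.
have near_t e : 0 < e -> F [set z : X | `|t - collapse z| < e].
  move=> e0; have [//|nF] := in_ultra_setVsetC [set z : X | `|t - collapse z| < e] UF.
  have [] := Ft [set r | ~ `|t - r| < e] (ball t e) nF; first exact: nbhsx_ballx.
  by move=> r [].
have : F [set z | (z <= xminus D t)%O] \/ F [set z | (xplus D t <= z)%O].
  have [|nF] := in_ultra_setVsetC [set z | (z <= xminus D t)%O] UF; first by left.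
  right; apply: filterS nF => z zt.
  by have [/zt|] := le_xminusVge_xplus z t01.
case=> Fz; [exists (xminus D t)|exists (xplus D t)]; split=> // U.
  move/(nbhs_xminus t01) => [d d0 dU]; near=> z; apply: dU; near: z => //.
  by apply: filterS (near_t _ d0) => z /=; rewrite ltr_distlC => /andP[].
move/(nbhs_xplus t01) => [d d0 dU]; near=> z; apply: dU; near: z => //.
by apply: filterS (near_t _ d0) => z /=; rewrite ltr_distlC => /andP[].
Unshelve. all: by end_near. Qed.

(* The cut between t^- and t^+ lies between x and y; false if t is not split. *)
Definition sep t x y :=
  [/\ D t, 0 < t < 1, (x <= xminus D t)%O & (xplus D t <= y)%O].

(* The points at which f jumps are among the cuts t^- < t^+, t \in F. *)
Definition step (F : seq R) (f : X -> int) :=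
  forall x y, (x <= y)%O -> (forall t, t \in F -> ~ sep t x y) -> f x = f y.

Lemma sepS t x x' y y' :
  (x' <= x)%O -> (y <= y')%O -> sep t x y -> sep t x' y'.
Proof.
by move=> xx yy [Dt t01 xt ty]; split=> //; [exact: le_trans xt|exact: le_trans yy].
Qed.

Lemma step_sub F F' f :
  (forall t, D t -> t \in F -> t \in F') -> step F f -> step F' f.
Proof.
move=> FF' Ff x y xy nsep; apply: Ff => // t tF.
by move=> s; apply: (nsep t _ s); apply: FF' => //; case: s.
Qed.

(** For each split t in F, the half line bounded by t^- or t^+ that contains x is open and is not
    crossed by the cut at t. Finitely many such neighbourhoods are intersected. *)
Lemma step_near F f x : step F f -> \forall y \near x, f y = f x.
Proof.
move=> Ff.
have : \forall y \near x, forall t, t \in F -> ~ sep t x y /\ ~ sep t y x.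
  elim: F {Ff} => [|t F IH]; first by apply: (@nearW _ (nbhs x)) => y t; rewrite in_nil.
  have : \forall y \near x, ~ sep t x y /\ ~ sep t y x.
    have [[Dt t01]|nt] := pselect (D t /\ 0 < t < 1); last first.
      by apply: (@nearW _ (nbhs x)) => y; split=> -[Dt t01] _ _; apply: nt.
    have /andP[t0 t1] := t01; have t01' : 0 <= t <= 1 by rewrite !ltW.
    have lt_t := xminus_lt_xplus Dt t01.
    have [xt|tx] := le_xminusVge_xplus x t01'.
      have : \forall y \near x, y \in `]-oo, xminus D t].
        apply: open_nbhs_nbhs; split; last by rewrite /= in_itv.
        by apply: open_le_xminus; rewrite // t0 ltW.
      apply: filterS => y; rewrite in_itv /= => yt; split=> -[_ _ h1 h2].
        by have := le_lt_trans (le_trans h2 yt) lt_t; rewrite ltxx.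
      by have := le_lt_trans (le_trans h2 xt) lt_t; rewrite ltxx.
    have : \forall y \near x, y \in `[xplus D t, +oo[.
      apply: open_nbhs_nbhs; split; last by rewrite /= in_itv andbT.
      by apply: open_ge_xplus; rewrite // t1 ltW.
    apply: filterS => y; rewrite in_itv /= andbT => yt; split=> -[_ _ h1 h2].
      by have := lt_le_trans lt_t (le_trans tx h1); rewrite ltxx.
    by have := lt_le_trans lt_t (le_trans yt h1); rewrite ltxx.
  move: IH; apply: filterS2 => y IH IHt s; rewrite inE => /predU1P[->//|].
  exact: IH.
apply: filterS => y nsep; have [xy|yx] := leP x y.
  by apply/esym/Ff => // t tF; have [] := nsep t tF.
by apply: Ff => [|t tF]; [exact: ltW|have [] := nsep t tF].
Qed.

Lemma step_local (f : CZ X) t : 0 <= t <= 1 ->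
  exists2 d : R, 0 < d & forall x y, (x <= y)%O -> t - d < collapse x ->
    collapse y < t + d -> ~ sep t x y -> f x = f y.
Proof.
move=> t01.
have [d1 d10 hd1] := nbhs_xminus t01 (CZ_locally_cst f (xminus D t)).
have [d2 d20 hd2] := nbhs_xplus t01 (CZ_locally_cst f (xplus D t)).
exists (Num.min d1 d2); first by rewrite lt_min d10.
move=> x y xy tx yt nsep.
have {}tx : t - d1 < collapse x.
  by apply: le_lt_trans tx; rewrite lerD2l lerN2 ge_min lexx.
have {}yt : collapse y < t + d2.
  by apply: lt_le_trans yt _; rewrite lerD2l ge_min lexx orbT.
have tx' := lt_le_trans tx (le_collapse xy).
have yt' := le_lt_trans (le_collapse xy) yt.
have [[Dt t01']|nt] := pselect (D t /\ 0 < t < 1).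
  have [yl|yr] := le_xminusVge_xplus y t01.
    by rewrite (hd1 x) ?(hd1 y)//; exact: le_trans yl.
  have [xl|xr] := le_xminusVge_xplus x t01; first by exfalso; apply: nsep.
  by rewrite (hd2 x) ?(hd2 y).
have e z : t - d1 < collapse z -> collapse z < t + d2 -> f z = f (xminus D t).
  move=> h1 h2; have [zl|zr] := le_xminusVge_xplus z t01; first exact: hd1.
  by rewrite -xplusN //; exact: hd2.
by rewrite !e.
Qed.

(** A supremum argument along [0,1]: let s be the supremum of the t such that f has finitely many
    jumps up to t. By [step_local] the only possible jump near s is at s itself, so the property
    passes beyond s unless 1 is reached. *)
Lemma CZ_step (f : CZ X) : exists F, step F f.
Proof.
pose P (t : R) := exists F : seq R, forall x y, (x <= y)%O -> collapse y <= t ->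
  (forall s, s \in F -> ~ sep s x y) -> f x = f y.
pose A := [set t : R | 0 <= t <= 1 /\ P t].
have A0 : A 0.
  split; first by rewrite lexx ler01.
  exists [::] => x y xy y0 _; have y0' : collapse y = 0.
    by apply/eqP; rewrite eq_le y0; case/andP: (collapse_itv y).
  have x0' : collapse x = 0.
    apply/eqP; rewrite eq_le -{1}y0' le_collapse //.
    by case/andP: (collapse_itv x).
  have e z : collapse z = 0 -> z = xminus D 0.
    move=> z0; have [] := xminus_or_xplus z; rewrite z0 // xplusN //.
    by case=> _; rewrite ltxx.
  by rewrite (e x) // (e y).
have supA : has_sup A.
  by split; [exists 0|exists 1 => t [/andP[]]].
set s := sup A.
have s01 : 0 <= s <= 1.
  apply/andP; split; first by apply: ub_le_sup => //; case: supA.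
  by apply: ge_sup; [exists 0|move=> t [/andP[]]].
have [d d0 hd] := step_local f s01.
have [t [t01 [F hF]] st] := sup_adherent d0 supA; rewrite -/s in st.
have ts : t <= s by apply: ub_le_sup; [case: supA|split=> //; exists F].
(* Half of d keeps t' strictly inside the window of radius d around s, and the minimum keeps it in
   [0,1]. *)
pose t' := Num.min 1 (s + d / 2).
have Pt' : P t'.
  exists (s :: F) => x y xy yt' nsep.
  have ysd : collapse y < s + d.
    apply: le_lt_trans yt' _; rewrite gt_min; apply/orP; right; lra.
  have nF r : r \in F -> ~ sep r x y.
    by move=> rF; apply: nsep; rewrite inE rF orbT.
  have ns : ~ sep s x y by apply: nsep; rewrite inE eqxx.
  have [yt|ty] := leP (collapse y) t; first exact: hF.
  have [sx|xs] := ltP (s - d) (collapse x); first exact: hd.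
  have xm : (x <= xminus D t)%O.
    by apply: ltW; apply: collapse_lt; rewrite collapse_xminus // (le_lt_trans xs).
  have my : (xminus D t <= y)%O.
    by apply: ltW; apply: collapse_lt; rewrite collapse_xminus.
  (* The pair x <= y is split at t^-: F controls the part up to t, and the rest lies within d of
     s. *)
  rewrite (hF x (xminus D t)) ?collapse_xminus //; last first.
    by move=> r rF rs; apply: (nF r rF); apply: sepS rs.
  apply: hd => //; first by rewrite collapse_xminus.
  by move=> rs; apply: ns; apply: sepS rs.
have [F' hF'] : P 1.
  (* As a member of A, t' is at most s; since d > 0, the minimum defining t' must then be 1. *)
  have : t' <= s.
    apply: ub_le_sup; first by case: supA.
    split=> //; rewrite /t' le_min ler01 ge_min lexx andbT /=.
    by apply: addr_ge0; [case/andP: s01|apply: divr_ge0 => //; exact: ltW].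
  rewrite /t'; case: (leP 1 (s + d / 2)) Pt' => [h|_].
    by rewrite /t'; case: (leP 1 (s + d / 2)) h.
  move=> _; lra.
by exists F' => x y xy nsep; apply: hF' => //; case/andP: (collapse_itv y).
Qed.

End Disconnection.

(** * Piecewise monotonic maps and generalized orbits *)

Lemma finite_inj_preimage {T U : Type} (P : set T) (f : T -> U) (A : set U) :
  finite_set A -> (forall x y, P x -> P y -> f x = f y -> x = y) ->
  finite_set (P `&` f @^-1` A).
Proof.
move=> Afin finj.
apply: (@sub_finite_set _ _ (\bigcup_(y in A) (P `&` f @^-1` [set y]))).
  by move=> x [Px Afx]; exists (f x).
apply: bigcup_finite => // y _.
have [->|/set0P[x0 [Px0 fx0]]] := eqVneq (P `&` f @^-1` [set y]) set0.
  exact: finite_set0.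
apply: (@sub_finite_set _ _ [set x0]); last exact: finite_set1.
by move=> x [Px fx]; apply: finj => //; rewrite fx0.
Qed.

Section RealLine.
Context {R : realType}.
Implicit Types (tau g : R -> R) (a b : nat -> R) (C : set R).

Lemma not_countable_itv (D : set R) (c d : R) : countable D -> c < d ->
  exists2 r, c < r < d & ~ D r.
Proof.
move=> Dc cd; apply: contrapT => nr.
have cdD : `]c, d[ `<=` D.
  move=> r /=; rewrite in_itv /= => rcd; apply: contrapT => nDr.
  by apply: nr; exists r.
have : countable `]c, d[%classic by exact: sub_countable (subset_card_le cdD) Dc.
move/countable_lebesgue_measure0; rewrite lebesgue_measure_itv /= lte_fin cd.
by move/eqP; rewrite -EFinB eqe subr_eq0 gt_eqF.
Qed.

Lemma partition_le q b i j : is_partition q b ->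
  (i <= j)%N -> (j <= q)%N -> b i <= b j.
Proof.
move=> [_ _ bS] ij; elim: j ij => [|j IH]; first by rewrite leqn0 => /eqP ->.
rewrite leq_eqVlt => /predU1P[-> //|ij jq].
exact: le_trans (IH ij (ltnW jq)) (ltW (bS _ jq)).
Qed.

Lemma partition_lt q b i j : is_partition q b ->
  (i < j)%N -> (j <= q)%N -> b i < b j.
Proof.
move=> bP ij jq; have [_ _ bS] := bP.
by apply: lt_le_trans (bS i (leq_trans ij jq)) (partition_le bP ij jq).
Qed.

Lemma partition_itv q b x : is_partition q b -> 0 <= x < 1 ->
  exists2 i, (i < q)%N & b i <= x < b i.+1.
Proof.
move=> bP /andP[x0 x1]; have [b0 bq bS] := bP.
have ex : exists i, (b i <= x) && (i <= q)%N by exists 0%N; rewrite b0 x0.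
have le_q i : (b i <= x) && (i <= q)%N -> (i <= q)%N by case/andP.
case: (ex_maxnP ex le_q) => i /andP[bix iq] imax.
have {}iq : (i < q)%N.
  rewrite ltn_neqAle iq andbT; apply/eqP => iqE.
  by move: bix; rewrite iqE bq leNgt x1.
exists i => //; rewrite bix ltNge; apply/negP => bi1.
by have := imax i.+1; rewrite bi1 iq ltnn => /(_ isT).
Qed.

Lemma partition_itv_oo q b x : is_partition q b -> 0 <= x <= 1 ->
  ~ partition_points q b x -> exists2 i, (i < q)%N & b i < x < b i.+1.
Proof.
move=> bP /andP[x0 x1] nx; have [b0 bq _] := bP.
have [i iq /andP[bi bi1]] : exists2 i, (i < q)%N & b i <= x < b i.+1.
  apply: partition_itv => //; rewrite x0 lt_neqAle x1 andbT.
  by apply/eqP => xE; apply: nx; exists q => //=; rewrite bq.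
exists i => //; rewrite bi1 andbT lt_neqAle bi andbT.
by apply/eqP => xE; apply: nx; exists i => //=; exact: leqW.
Qed.

Lemma finite_partition_points q b : finite_set (partition_points q b).
Proof. by apply: finite_image; exact: finite_II. Qed.

Lemma lim_set_unitI tau x : {homo tau : x / unitI x} ->
  lim_set tau x `<=` unitI.
Proof.
have cl01 : closed (unitI : set R) by exact: itv_closed.
move=> tauI y [] [/andP[x0 x1] ty].
  apply: (closed_cvg unitI cl01 _ _ ty); near=> z; apply: tauI.
  rewrite /unitI /= in_itv /=; apply/andP; split.
    by apply: ltW; near: z; exact: nbhs_left_gt.
  by apply: le_trans x1; apply: ltW; near: z; exact: nbhs_left_lt.
apply: (closed_cvg unitI cl01 _ _ ty); near=> z; apply: tauI.
rewrite /unitI /= in_itv /=; apply/andP; split.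
  by apply: le_trans x0 _; apply: ltW; near: z; exact: nbhs_right_gt.
by apply: ltW; near: z; exact: nbhs_right_lt.
Unshelve. all: by end_near. Qed.

Lemma lim_set_continuous tau x y : tau z @[z --> x] --> tau x ->
  lim_set tau x y -> y = tau x.
Proof.
move=> ct [] [_ ty].
  exact: (cvg_unique (@norm_hausdorff _ _) ty (cvg_at_left_filter ct)).
exact: (cvg_unique (@norm_hausdorff _ _) ty (cvg_at_right_filter ct)).
Qed.

Lemma lim_set_mem tau (x : R) : 0 < x < 1 -> tau z @[z --> x] --> tau x ->
  lim_set tau x (tau x).
Proof.
move=> /andP[x0 x1] ct; left; split; first by rewrite x0 ltW.
exact: cvg_at_left_filter.
Qed.

Lemma homo_lim_bound g (c d y : R) : c < d ->
  {in `]c, d[ &, {homo g : x y / x <= y}} ->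
  (g z @[z --> d^'-] --> y -> ubound (g @` `]c, d[) y) /\
  (g z @[z --> c^'+] --> y -> lbound (g @` `]c, d[) y).
Proof.
move=> cd gm; split=> gy _ [z /= zcd <-]; have := zcd; rewrite in_itv /= => /andP[cz zd].
  apply: (closed_cvg [set r | g z <= r] _ _ _ gy); first exact: closed_ge.
  near=> w; have zw : z < w by near: w; exact: nbhs_left_gt.
  apply: gm => //; last exact: ltW.
  rewrite in_itv /= (lt_trans cz) //=; near: w; exact: nbhs_left_lt.
apply: (closed_cvg [set r | r <= g z] _ _ _ gy); first exact: closed_le.
near=> w; have zw : w < z by near: w; exact: nbhs_right_lt.
apply: gm => //; last exact: ltW.
by rewrite in_itv /= (lt_trans _ zd) ?andbT //=; near: w; exact: nbhs_right_gt.
Unshelve. all: by end_near. Qed.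

Lemma mono_lim_bound g (c d y : R) : c < d ->
  {in `]c, d[ &, {homo g : x y / x <= y}} \/
  {in `]c, d[ &, {homo g : x y /~ x <= y}} ->
  g z @[z --> d^'-] --> y \/ g z @[z --> c^'+] --> y ->
  closure (g @` `]c, d[) y /\
  (ubound (g @` `]c, d[) y \/ lbound (g @` `]c, d[) y).
Proof.
move=> cd gm gy; split.
  move=> U Uy; case: gy => /(_ U Uy) gU.
    have : \forall z \near d^'-, U (g z) /\ c < z < d.
      near=> z; split; first by near: z; exact: gU.
      by apply/andP; split; near: z; [exact: nbhs_left_gt|exact: nbhs_left_lt].
    case/(@filter_ex _ d^'- _) => z [Uz zcd]; exists (g z); split=> //; exists z => //.
  have : \forall z \near c^'+, U (g z) /\ c < z < d.
    near=> z; split; first by near: z; exact: gU.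
    by apply/andP; split; near: z; [exact: nbhs_right_gt|exact: nbhs_right_lt].
  by case/(@filter_ex _ c^'+ _) => z [Uz zcd]; exists (g z); split=> //; exists z.
case: gm => gm; first by have [] := homo_lim_bound y cd gm; case: gy; tauto.
have gm' : {in `]c, d[ &, {homo (fun z => - g z) : x y / x <= y}}.
  by move=> u v u_ v_ uv; rewrite lerN2; exact: gm.
have [h1 h2] := homo_lim_bound (- y) cd gm'; case: gy => gy.
  right=> _ [z zcd <-]; rewrite -lerN2; apply: h1; last by exists z.
  exact: cvgN.
left=> _ [z zcd <-]; rewrite -lerN2; apply: h2; last by exists z.
exact: cvgN.
Unshelve. all: by end_near. Qed.

(** By monotonicity, a limit at an end of the interval is an extreme point of the closure of the
    image. That closure is a union of Markov intervals, and an extreme point of such a union can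
    only be an end of one of them. *)
Lemma markov_lim_bound tau C q b i y : markov_partition tau C q b ->
  (i < q)%N ->
  tau z @[z --> (b i.+1)^'-] --> y \/ tau z @[z --> (b i)^'+] --> y ->
  partition_points q b y.
Proof.
move=> [bP _ bm bcl _] iq ty; have [_ _ bS] := bP.
have [cy bnd] := mono_lim_bound (bS i iq) (bm i iq) ty.
have [J JE] := bcl i iq.
have := cy; rewrite JE => -[j Jj]; rewrite /= in_itv /= => /andP[jy yj].
have cl_itv z : b j <= z <= b j.+1 -> closure (tau @` `]b i, b i.+1[) z.
  by move=> zj; rewrite JE; exists j.
have lej : b j <= b j.+1 by exact/ltW/bS.
case: bnd => bnd.
  exists j.+1; first exact: (ltn_ord j).
  apply/eqP; rewrite eq_le yj andbT.
  have clle : closed [set r | r <= y] by exact: closed_le.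
  have := closure_subset (B := [set r | r <= y]) bnd.
  by rewrite -((closure_id _).1 clle); apply; apply: cl_itv; rewrite lexx lej.
exists j; first exact: (leqW (ltn_ord j)).
apply/eqP; rewrite eq_le jy /=.
have clge : closed [set r | y <= r] by exact: closed_ge.
have := closure_subset (B := [set r | y <= r]) bnd.
by rewrite -((closure_id _).1 clge); apply; apply: cl_itv; rewrite lexx lej.
Qed.

End RealLine.

(** * The generalized orbit is countable *)

Section GeneralizedOrbit.
Context {R : realType}.
Variables (tau : R -> R) (n : nat) (a : nat -> R).
Hypothesis tau_pm : piecewise_monotonic tau n a.
Local Notation C := (partition_points n a).
Local Notation I1 := (gen_orbit tau C).

Lemma orbitC : C `<=` I1. Proof. exact: sub_gen_smallest. Qed.

Lemma orbit_lim_set t : I1 t -> lim_set tau t `<=` I1.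
Proof.
move=> It y ty A AP; have [[_ Alim _] _] := AP; apply: Alim; exists t => //.
exact: (It A AP).
Qed.

Lemma orbit_preimage (x y : R) : 0 <= x <= 1 -> lim_set tau x y -> I1 y -> I1 x.
Proof.
move=> x01 xy Iy A AP; have [[_ _ Apre] _] := AP; apply: Apre.
split; first by rewrite /unitI /= in_itv.
by exists y; split=> //; exact: (Iy A AP).
Qed.

Lemma tau_continuous (x : R) : 0 <= x <= 1 -> ~ C x -> tau z @[z --> x] --> tau x.
Proof.
move=> x01 nCx; have [_ aP am] := tau_pm.
have [i iq xi] := partition_itv_oo aP x01 nCx.
by have [+ _] := am i iq; apply.
Qed.

Lemma not_points (x : R) : 0 <= x <= 1 -> ~ C x -> 0 < x < 1.
Proof.
move=> /andP[x0 x1] nCx; have [_ [a0 an _] _] := tau_pm.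
rewrite !lt_neqAle x0 x1 !andbT; apply/andP; split; apply/eqP => xE.
  by apply: nCx; exists 0%N => //; rewrite a0.
by apply: nCx; exists n => //=; rewrite an.
Qed.

Lemma tau_not_orbit (x : R) : 0 <= x <= 1 -> ~ I1 x -> ~ I1 (tau x).
Proof.
move=> x01 nIx It; have nCx : ~ C x by move/orbitC.
apply: nIx; apply: orbit_preimage It => //.
apply: lim_set_mem; first exact: not_points.
exact: tau_continuous.
Qed.

Section Landing.
Variables (q : nat) (b : nat -> R).
Hypothesis bM : markov_partition tau C q b.

(** The points all of whose chains of k one-sided limits end at Markov points. All limits are
    required because t^- and t^+ may follow different ones. Points outside [0,1] have no limits, so
    they belong vacuously as soon as k > 0; hence the intersections with [unitI] below. *)
Definition landing k : set R :=
  iter k (fun A => [set x | lim_set tau x `<=` A]) (partition_points q b).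

Lemma landingS k : landing k `<=` landing k.+1.
Proof.
elim: k => [|k IH] x; last by move=> xk y xy; apply: IH; exact: xk.
move=> [i iq <-] y; have [bP _ _ _ _] := bM; have [b0 bq _] := bP.
case=> -[/andP[bi0 bi1] ty].
  case: i iq bi0 bi1 ty => [|i] /= iq bi0 bi1 ty; first by rewrite b0 ltxx in bi0.
  by apply: (markov_lim_bound (i := i) bM) => //; left.
have {}iq : (i < q)%N.
  rewrite ltn_neqAle -ltnS iq andbT; apply/eqP => iE.
  by rewrite iE bq ltxx in bi1.
by apply: (markov_lim_bound bM iq); right.
Qed.

Lemma landing_le k l : (k <= l)%N -> landing k `<=` landing l.
Proof.
elim: l => [|l IH]; first by rewrite leqn0 => /eqP ->.
rewrite leq_eqVlt => /predU1P[-> //|kl].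
exact: subset_trans (IH kl) (@landingS l).
Qed.

Lemma sub_landing k (A : set R) :
  iter k (lim_image tau) A `<=` partition_points q b -> A `<=` landing k.
Proof.
elim: k A => [//|k IH] A; rewrite iterSr => /IH sub x Ax y xy.
by apply: sub; exists x.
Qed.

(** By minimality of I_1 it suffices that the right-hand side contains C and is closed both ways.
    For preimages, one limit in a landing set must force all limits into one: off C the map is
    continuous and has a single limit, while points of C land by the Markov hypothesis. *)
Lemma orbit_landing : I1 `<=` unitI `&` \bigcup_k landing k.
Proof.
have [bP _ _ _ [k Ck]] := bM; have [tauI aP _] := tau_pm.
apply: smallest_sub.
  split; first by move=> x [].
    move=> y [x [Ix [l _ xl]] xy]; split; first exact: lim_set_unitI xy.
    by exists l => //; exact: (landingS xl).
  move=> x [Ix [y [xy [Iy [l _ yl]]]]]; split=> //.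
  have x01 : 0 <= x <= 1 by move: Ix; rewrite /unitI /= in_itv.
  have [Cx|nCx] := pselect (C x); first by exists k => //; exact: sub_landing Ck _ Cx.
  exists l.+1 => // z xz; have ct := tau_continuous x01 nCx.
  by rewrite (lim_set_continuous ct xz) -(lim_set_continuous ct xy).
move=> x Cx; split; last by exists k => //; exact: sub_landing Ck _ Cx.
case: Cx => i /= iq <-; rewrite /unitI /= in_itv /=.
have [a0 an _] := aP; rewrite ltnS in iq.
by rewrite -{1}a0 -an !(partition_le aP).
Qed.

Lemma tau_inj_itv i x y : (i < n)%N -> a i < x < a i.+1 -> a i < y < a i.+1 ->
  tau x = tau y -> x = y.
Proof.
have [_ _ am] := tau_pm => iq xi yi txy.
have [_ am'] := am i iq.
have aux u v : a i < u < a i.+1 -> a i < v < a i.+1 -> u < v -> tau u <> tau v.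
  move=> ui vi uv tE.
  case: am' => am'; [have := am' u v ui vi uv|have := am' v u vi ui uv].
    by rewrite tE ltxx.
  by rewrite tE ltxx.
by case: (ltgtP x y) => // xy; exfalso; apply: (aux _ _ _ _ xy).
Qed.

(** Outside the finite set C, a point of [landing k.+1] is a preimage of a point of [landing k]
    under one of n injective branches. *)
Lemma finite_landing k : finite_set (unitI `&` landing k).
Proof.
elim: k => [|k IH].
  exact: sub_finite_set (@subIsetr _ _ _) (finite_partition_points _ _).
have [tauI aP _] := tau_pm.
apply: (@sub_finite_set _ _ (C `|` \bigcup_(i in `I_n)
    ([set x | a i < x < a i.+1] `&` tau @^-1` (unitI `&` landing k)))).
  move=> x [Ix xk]; have [Cx|nCx] := pselect (C x); [by left|right].
  have x01 : 0 <= x <= 1 by move: Ix; rewrite /unitI /= in_itv.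
  have [i iq xi] := partition_itv_oo aP x01 nCx.
  exists i => //; split=> //; split; first exact: tauI.
  apply: xk; apply: lim_set_mem; first exact: not_points.
  exact: tau_continuous.
rewrite finite_setU; split; first exact: finite_partition_points.
apply: bigcup_finite; first exact: finite_II.
move=> i iq; apply: finite_inj_preimage => // x y xi yi.
exact: (tau_inj_itv iq).
Qed.

Lemma countable_orbit : countable I1.
Proof.
apply: (@sub_countable _ _ _ (\bigcup_k (unitI `&` landing k))).
  by apply: subset_card_le => x /orbit_landing[Ix [k _ xk]]; exists k.
apply: bigcup_countable => // k _.
exact/finite_set_countable/finite_landing.
Qed.

Lemma orbitN_dense (c d : R) : c < d -> exists2 r, c < r < d & ~ I1 r.
Proof. exact: not_countable_itv countable_orbit. Qed.

End Landing.
End GeneralizedOrbit.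

(** * Monotone maps on an order interval of the disconnection *)

Section MonotoneExtension.
Context {R : realType}.
Variable D : set R.
Local Notation X := (disconnection D).
Hypothesis Ddense : forall u v : R, u < v -> exists2 r, u < r < v & ~ D r.
Variables c d : R.
Hypotheses (c0 : 0 <= c) (cd : c < d) (d1 : d <= 1).
Local Notation P := (`[xplus D c, xminus D d]%classic : set X).

Let in01 t : c <= t <= d -> 0 <= t <= 1.
Proof.
by move=> /andP[ct td]; rewrite (le_trans c0 ct) (le_trans td d1).
Qed.

Let c01 : 0 <= c <= 1. Proof. by apply: in01; rewrite lexx ltW. Qed.
Let d01 : 0 <= d <= 1. Proof. by apply: in01; rewrite lexx ltW. Qed.

Lemma piece_collapse (x : X) : P x -> c <= collapse x <= d.
Proof.
rewrite /= in_itv /= => /andP[/le_collapse + /le_collapse].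
by rewrite collapse_xplus // collapse_xminus // => -> ->.
Qed.

Lemma piece_mem (x : X) : c < collapse x < d -> P x.
Proof.
move=> /andP[cx xd]; rewrite /= in_itv /=.
by apply/andP; split; apply: ltW; apply: collapse_lt;
  rewrite ?collapse_xplus ?collapse_xminus.
Qed.

Lemma piece_xminus t : c < t <= d -> P (xminus D t).
Proof.
move=> /andP[ct td]; rewrite /= in_itv /=; apply/andP; split.
  apply: ltW; apply: collapse_lt.
  by rewrite collapse_xplus // collapse_xminus // in01 // ltW.
move: td; rewrite (le_eqVlt t) => /predU1P[->//|td]; apply: ltW; apply: collapse_lt.
by rewrite !collapse_xminus // in01 // !ltW.
Qed.

Lemma piece_xplus t : c <= t < d -> P (xplus D t).
Proof.
move=> /andP[ct td]; rewrite /= in_itv /=; apply/andP; split; last first.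
  apply: ltW; apply: collapse_lt.
  by rewrite collapse_xplus ?collapse_xminus // in01 // ct ltW.
move: ct; rewrite (le_eqVlt c) => /predU1P[->//|ct]; apply: ltW; apply: collapse_lt.
by rewrite !collapse_xplus // in01 // !ltW.
Qed.

(** P contains c only as c^+ and d only as d^-. Hence each of its points can be approached from a
    side that stays over the open interval. *)
Lemma piece_side (x : X) : P x ->
  (x = xminus D (collapse x) /\ c < collapse x) \/
  (x = xplus D (collapse x) /\ collapse x < d).
Proof.
move=> Px; have /andP[cx xd] := piece_collapse Px.
move: Px; rewrite /= in_itv /= => /andP[cx' xd'].
have [xE|xE] := xminus_or_xplus x.
  have [cx1|xc] := ltP c (collapse x); first by left.
  have tE : collapse x = c by apply/eqP; rewrite eq_le xc.
  right; rewrite tE; split=> //; apply/eqP; rewrite eq_le cx' andbT.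
  by rewrite {1}xE tE; exact: xminus_le_xplus.
have [xd1|dx] := ltP (collapse x) d; first by right.
have tE : collapse x = d by apply/eqP; rewrite eq_le xd.
left; rewrite tE; split=> //; apply/eqP; rewrite eq_le xd' /=.
by rewrite [X in (_ <= X)%O]xE tE; exact: xminus_le_xplus.
Qed.

(** Density of X_0 in the piece, with approximants over the open interval, where the hypotheses on
    the real map apply. *)
Lemma piece_nbhs (x : X) U : P x -> nbhs x U ->
  exists r, [/\ c < r < d, ~ D r & U (xminus D r)].
Proof.
move=> Px Ux; have x01 := collapse_itv x.
have /andP[cx xd] := piece_collapse Px.
have [[xE ct]|[xE td]] := piece_side Px; rewrite {1}xE in Ux.
  have [e e0 eU] := nbhs_xminus x01 Ux.
  have [|r /andP[r1 r2] nDr] := @Ddense (Num.max c (collapse x - e)) (collapse x).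
    by rewrite gt_max ct ltrBlDr ltrDl.
  move: r1; rewrite gt_max => /andP[cr er].
  have rd := lt_le_trans r2 xd.
  have r01 : 0 <= r <= 1 by rewrite in01 // !ltW.
  exists r; split; rewrite ?cr //; apply: eU; last by rewrite collapse_xminus.
  by apply: ltW; apply: collapse_lt; rewrite !collapse_xminus.
have [e e0 eU] := nbhs_xplus x01 Ux.
have [|r /andP[r1 r2] nDr] := @Ddense (collapse x) (Num.min d (collapse x + e)).
  by rewrite lt_min td ltrDl.
move: r2; rewrite lt_min => /andP[rd re].
have cr := le_lt_trans cx r1.
have r01 : 0 <= r <= 1 by rewrite in01 // !ltW.
exists r; split; rewrite ?cr //; apply: eU; last by rewrite collapse_xminus.
by apply: ltW; apply: collapse_lt; rewrite collapse_xplus ?collapse_xminus.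
Qed.

Section Increasing.
Variables (phi : X -> R) (g : R -> R).
Hypothesis phic : continuous phi.
Hypothesis phig : forall r, c < r < d -> ~ D r -> phi (xminus D r) = g r.
Hypothesis gincr : {in `]c, d[ &, {homo g : x y / x < y}}.

(** Over D the function [phi] is known only by continuity. If [phi x] exceeded g(r), so would g(s)
    at some s < r outside D near x, against monotonicity of g. *)
Let phi_le (x : X) r : P x -> c < r < d -> ~ D r -> collapse x < r -> phi x <= g r.
Proof.
move=> Px rcd nDr xr; rewrite leNgt; apply/negP => lt_g.
have U1 : \forall y \near x, g r < phi y by exact: (cvgr_gt _ (@phic x) _ lt_g).
have U2 : \forall y \near x, collapse y < r.
  by apply: open_nbhs_nbhs; split=> //; exact: open_collapse_lt.
have [s [scd nDs [s1 s2]]] := piece_nbhs Px (filterI U1 U2).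
have /andP[cs sd] := scd.
rewrite /= phig // collapse_xminus ?in01 ?ltW // in s1 s2.
by have := lt_trans s1 (gincr scd rcd s2); rewrite ltxx.
Qed.

Let phi_ge (x : X) r : P x -> c < r < d -> ~ D r -> r < collapse x -> g r <= phi x.
Proof.
move=> Px rcd nDr xr; rewrite leNgt; apply/negP => lt_g.
have U1 : \forall y \near x, phi y < g r by exact: (cvgr_lt _ (@phic x) _ lt_g).
have U2 : \forall y \near x, r < collapse y.
  by apply: open_nbhs_nbhs; split=> //; exact: open_collapse_gt.
have [s [scd nDs [s1 s2]]] := piece_nbhs Px (filterI U1 U2).
have /andP[cs sd] := scd.
rewrite /= phig // collapse_xminus ?in01 ?ltW // in s1 s2.
by have := lt_trans s1 (gincr rcd scd s2); rewrite ltxx.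
Qed.

(** Two points r < s outside D are inserted between x and y; g(r) < g(s) makes the inequality
    strict. The function [phi] is kept abstract so that the decreasing case can later be treated by
    changing signs. *)
Lemma phi_incr (x y : X) : P x -> P y -> collapse x < collapse y -> phi x < phi y.
Proof.
move=> Px Py xy; have /andP[cx xd] := piece_collapse Px.
have /andP[cy yd] := piece_collapse Py.
have [r /andP[xr ry] nDr] := Ddense xy.
have [s /andP[rs sy] nDs] := Ddense ry.
have rcd : c < r < d by rewrite (le_lt_trans cx xr) (lt_le_trans ry yd).
have scd : c < s < d.
  by rewrite (lt_trans _ rs) ?(lt_le_trans sy yd) //; case/andP: rcd.
apply: le_lt_trans (phi_le Px rcd nDr xr) _.
by apply: lt_le_trans (phi_ge Py scd nDs sy); exact: gincr.
Qed.

Lemma phi_jump t : c < t < d -> phi (xminus D t) <= phi (xplus D t).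
Proof.
move=> /andP[ct td]; rewrite leNgt; apply/negP => lt_phi.
have Pm : P (xminus D t) by apply: piece_xminus; rewrite ct ltW.
have t01 : 0 <= t <= 1 by rewrite in01 // !ltW.
have U1 : \forall y \near xplus D t, phi y < phi (xminus D t).
  exact: (cvgr_lt _ (@phic _) _ lt_phi).
have [e e0 eU] := nbhs_xplus t01 U1.
have [|r /andP[r1 r2] nDr] := @Ddense t (Num.min d (t + e)).
  by rewrite lt_min td ltrDl.
move: r2; rewrite lt_min => /andP[rd re].
have rcd : c < r < d by rewrite (lt_trans ct r1).
have r01 : 0 <= r <= 1 by rewrite in01 // (ltW rd) andbT (ltW (lt_trans ct r1)).
have : g r < phi (xminus D t).
  rewrite -phig //; apply: eU; last by rewrite collapse_xminus.
  by apply: ltW; apply: collapse_lt; rewrite collapse_xplus ?collapse_xminus.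
by rewrite ltNge phi_le // collapse_xminus.
Qed.

(** At points of D the value of g is unrelated to [phi], so g(z) is squeezed between g(r) and g(s)
    with r < z < s < t and r, s outside D. *)
Lemma phi_left t : c < t <= d -> g z @[z --> t^'-] --> phi (xminus D t).
Proof.
move=> tcd; have /andP[ct td] := tcd; have Pt := piece_xminus tcd.
have t01 : 0 <= t <= 1 by rewrite in01 // ltW.
apply/cvgrPdist_lt => e e0.
have U1 : \forall y \near xminus D t, phi (xminus D t) - e < phi y.
  by apply: (cvgr_gt _ (@phic _) _ _); rewrite ltrBlDr ltrDl.
have [h h0 hU] := nbhs_xminus t01 U1.
have [|r /andP[r1 r2] nDr] := @Ddense (Num.max c (t - h)) t.
  by rewrite gt_max ct ltrBlDr ltrDl.
move: r1; rewrite gt_max => /andP[cr hr].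
have rd := lt_le_trans r2 td.
have rcd : c < r < d by rewrite cr rd.
have r01 : 0 <= r <= 1 by rewrite in01 // !ltW.
have lt_gr : phi (xminus D t) - e < g r.
  rewrite -phig //; apply: hU; last by rewrite collapse_xminus.
  by apply: ltW; apply: collapse_lt; rewrite !collapse_xminus.
near=> z.
have rz : r < z by near: z; exact: nbhs_left_gt.
have zt : z < t by near: z; exact: nbhs_left_lt.
have zcd : c < z < d by rewrite (lt_trans cr rz) (lt_le_trans zt td).
have lt_gz : g r < g z by exact: gincr.
have [s /andP[zs st] nDs] := Ddense zt.
have scd : c < s < d.
  by rewrite (lt_le_trans st td) andbT (lt_trans (lt_trans cr rz) zs).
have gzs : g z < g s by exact: gincr.
have gs : g s <= phi (xminus D t).
  by apply: phi_ge => //; rewrite collapse_xminus.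
by rewrite ltr_distlC (lt_trans lt_gr lt_gz) (lt_le_trans gzs) // (le_trans gs) // lerDl ltW.
Unshelve. all: by end_near. Qed.

Lemma phi_right t : c <= t < d -> g z @[z --> t^'+] --> phi (xplus D t).
Proof.
move=> tcd; have /andP[ct td] := tcd; have Pt := piece_xplus tcd.
have t01 : 0 <= t <= 1 by rewrite in01 // ct ltW.
apply/cvgrPdist_lt => e e0.
have U1 : \forall y \near xplus D t, phi y < phi (xplus D t) + e.
  by apply: (cvgr_lt _ (@phic _) _ _); rewrite ltrDl.
have [h h0 hU] := nbhs_xplus t01 U1.
have [|r /andP[r1 r2] nDr] := @Ddense t (Num.min d (t + h)).
  by rewrite lt_min td ltrDl.
move: r2; rewrite lt_min => /andP[rd hr].
have cr := le_lt_trans ct r1.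
have rcd : c < r < d by rewrite cr rd.
have r01 : 0 <= r <= 1 by rewrite in01 // !ltW.
have lt_gr : g r < phi (xplus D t) + e.
  rewrite -phig //; apply: hU; last by rewrite collapse_xminus.
  by apply: ltW; apply: collapse_lt; rewrite collapse_xplus ?collapse_xminus.
near=> z.
have rz : z < r by near: z; exact: nbhs_right_lt.
have zt : t < z by near: z; exact: nbhs_right_gt.
have zcd : c < z < d by rewrite (le_lt_trans ct zt) (lt_trans rz rd).
have lt_gz : g z < g r by exact: gincr.
have [s /andP[ts sz] nDs] := Ddense zt.
have scd : c < s < d.
  by rewrite (le_lt_trans ct ts) (lt_trans (lt_trans sz rz) rd).
have gzs : g s < g z by exact: gincr.
have gs : phi (xplus D t) <= g s.
  by apply: phi_le => //; rewrite collapse_xplus.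
rewrite ltr_distlC (lt_trans lt_gz lt_gr) andbT.
by apply: lt_trans gzs; apply: lt_le_trans gs; rewrite ltrBlDr ltrDl.
Unshelve. all: by end_near. Qed.

End Increasing.
End MonotoneExtension.

(** * The action of sigma on points and cuts of one interval *)

Section Branch.
Context {R : realType}.
Variable D : set R.
Local Notation X := (disconnection D).
Hypothesis Ddense : forall u v : R, u < v -> exists2 r, u < r < v & ~ D r.
Variables (tau : R -> R) (sigma : X -> X).
Hypothesis sigmac : continuous sigma.
Hypothesis sigma_tau :
  forall x, ~ D (collapse x) -> collapse (sigma x) = tau (collapse x).
Hypothesis lim_setD : forall t, D t -> lim_set tau t `<=` D.
Variables c d : R.
Hypotheses (c0 : 0 <= c) (cd : c < d) (d1 : d <= 1).
Local Notation P := (`[xplus D c, xminus D d]%classic : set X).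
Local Notation phi := (fun x => collapse (sigma x)).

Let in01 t : c < t < d -> 0 < t < 1.
Proof.
by move=> /andP[ct td]; rewrite (le_lt_trans c0 ct) (lt_le_trans td d1).
Qed.

Let phi_continuous : continuous phi.
Proof.
by move=> x; apply: continuous_comp; [exact: sigmac|exact: collapse_continuous].
Qed.

Let phi_tau r : c < r < d -> ~ D r -> phi (xminus D r) = tau r.
Proof.
move=> /in01/andP[r0 r1] nDr.
have r01 : 0 <= r <= 1 by rewrite !ltW.
by rewrite sigma_tau collapse_xminus.
Qed.

Let phi01 x : 0 <= phi x <= 1. Proof. exact: collapse_itv. Qed.

(** Were the image s^+ with s split, the half line above s^+ would be a neighbourhood of it. By
    continuity no point close to p could then have its image over a real below s. *)
Lemma xminus_of_lt p :
  (forall U, nbhs p U -> exists2 z, U z & phi z < phi p) ->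
  sigma p = xminus D (phi p).
Proof.
move=> Up; have [//|E] := xminus_or_xplus (sigma p).
have [[Ds s01]|ns] := pselect (D (phi p) /\ 0 < phi p < 1); last first.
  by rewrite -xplusN.
have [s0 s1] := andP s01.
have oS : open `[xplus D (phi p), +oo[%classic.
  by apply: open_ge_xplus; rewrite // s1 ltW.
have nS : nbhs (sigma p) `[xplus D (phi p), +oo[%classic.
  by apply: open_nbhs_nbhs; split=> //; rewrite /= in_itv /= andbT -E.
have [z /= + lt_z] := Up _ (sigmac nS).
rewrite in_itv /= andbT => /le_collapse; rewrite collapse_xplus ?phi01 // => le_z.
by have := lt_le_trans lt_z le_z; rewrite ltxx.
Qed.

Lemma xplus_of_gt p :
  (forall U, nbhs p U -> exists2 z, U z & phi p < phi z) ->
  sigma p = xplus D (phi p).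
Proof.
move=> Up; have [E|//] := xminus_or_xplus (sigma p).
have [[Ds s01]|ns] := pselect (D (phi p) /\ 0 < phi p < 1); last first.
  by rewrite xplusN.
have [s0 s1] := andP s01.
have oS : open `]-oo, xminus D (phi p)]%classic.
  by apply: open_le_xminus; rewrite // s0 ltW.
have nS : nbhs (sigma p) `]-oo, xminus D (phi p)]%classic.
  by apply: open_nbhs_nbhs; split=> //; rewrite /= in_itv /= -E.
have [z /= + lt_z] := Up _ (sigmac nS).
rewrite in_itv /= => /le_collapse; rewrite collapse_xminus ?phi01 // => le_z.
by have := lt_le_trans lt_z le_z; rewrite ltxx.
Qed.

Let left_point t U : c < t < d -> nbhs (xminus D t) U ->
  exists z, [/\ P z, U z & collapse z < t].
Proof.
move=> tcd Ut; have /andP[t0 t1] := in01 tcd.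
have t01 : 0 <= t <= 1 by rewrite !ltW.
have [e e0 eU] := nbhs_xminus t01 Ut; have /andP[ct td] := tcd.
have [|r /andP[r1 r2] _] := @Ddense (Num.max c (t - e)) t.
  by rewrite gt_max ct ltrBlDr ltrDl.
move: r1; rewrite gt_max => /andP[cr er].
have rcd : c < r < d by rewrite cr (lt_trans r2 td).
have r01 : 0 <= r <= 1 by have /andP[? ?] := in01 rcd; rewrite !ltW.
exists (xminus D r); rewrite collapse_xminus //; split=> //.
  by apply: (piece_mem c0 cd d1); rewrite collapse_xminus.
apply: eU; last by rewrite collapse_xminus.
by apply: ltW; apply: collapse_lt; rewrite !collapse_xminus.
Qed.

Let right_point t U : c < t < d -> nbhs (xplus D t) U ->
  exists z, [/\ P z, U z & t < collapse z].
Proof.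
move=> tcd Ut; have /andP[t0 t1] := in01 tcd.
have t01 : 0 <= t <= 1 by rewrite !ltW.
have [e e0 eU] := nbhs_xplus t01 Ut; have /andP[ct td] := tcd.
have [|r /andP[r1 r2] _] := @Ddense t (Num.min d (t + e)).
  by rewrite lt_min td ltrDl.
move: r2; rewrite lt_min => /andP[rd er].
have rcd : c < r < d by rewrite rd (lt_trans ct r1).
have r01 : 0 <= r <= 1 by have /andP[? ?] := in01 rcd; rewrite !ltW.
exists (xminus D r); rewrite collapse_xminus //; split=> //.
  by apply: (piece_mem c0 cd d1); rewrite collapse_xminus.
apply: eU; last by rewrite collapse_xminus.
by apply: ltW; apply: collapse_lt; rewrite collapse_xplus ?collapse_xminus.
Qed.

Let xminusP t : c < t < d -> P (xminus D t).
Proof. by move=> /andP[ct td]; apply: (piece_xminus D c0 cd d1); rewrite ct ltW. Qed.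

Let xplusP t : c < t < d -> P (xplus D t).
Proof. by move=> /andP[ct td]; apply: (piece_xplus D c0 cd d1); rewrite td ltW. Qed.

Let collapse_m t : c < t < d -> collapse (xminus D t) = t.
Proof. by move=> /in01/andP[t0 t1]; rewrite collapse_xminus // !ltW. Qed.

Let collapse_p t : c < t < d -> collapse (xplus D t) = t.
Proof. by move=> /in01/andP[t0 t1]; rewrite collapse_xplus // !ltW. Qed.

Let at_left_mem t y : c < t < d -> tau z @[z --> t^'-] --> y -> lim_set tau t y.
Proof. by move=> /in01/andP[t0 t1] ty; left; split=> //; rewrite t0 ltW. Qed.

Let at_right_mem t y : c < t < d -> tau z @[z --> t^'+] --> y -> lim_set tau t y.
Proof. by move=> /in01/andP[t0 t1] ty; right; split=> //; rewrite t1 ltW. Qed.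

Let adjacent x y : P x -> P y -> (x < y)%O -> collapse x = collapse y ->
  [/\ D (collapse x), c < collapse x < d, x = xminus D (collapse x) &
      y = xplus D (collapse x)].
Proof.
move=> Px Py xy e.
have xE : x = xminus D (collapse x).
  have [//|xE] := xminus_or_xplus x.
  by have := le_xplus y; rewrite -e -xE leNgt xy.
have yE : y = xplus D (collapse x).
  rewrite e; have [yE|//] := xminus_or_xplus y.
  by have := xminus_le x; rewrite e -yE leNgt xy.
have [[Dt t01]|nt] := pselect (D (collapse x) /\ 0 < collapse x < 1); last first.
  by move: xy; rewrite yE xplusN // -xE ltxx.
split=> //.
have /andP[cx xd] := piece_collapse c0 cd d1 Px.
apply/andP; split; rewrite lt_neqAle; apply/andP; split=> //; apply/eqP => tE.
  move: Px; rewrite /= in_itv /= tE -yE => /andP[yx _].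
  by have := lt_le_trans xy yx; rewrite ltxx.
move: Py; rewrite /= in_itv /= -tE -xE => /andP[_ yx].
by have := lt_le_trans xy yx; rewrite ltxx.
Qed.

Section Increasing.
Hypothesis tau_incr : {in `]c, d[ &, {homo tau : x y / x < y}}.

Let lt_phi := phi_incr Ddense c0 cd d1 phi_continuous phi_tau tau_incr.

Lemma image_xminus_gt0 t : c < t < d -> 0 < phi (xminus D t).
Proof.
move=> tcd; have [z [Pz _ zt]] := left_point tcd filterT.
have /andP[z0 _] := phi01 z; apply: le_lt_trans z0 _.
by apply: lt_phi => //; [exact: xminusP|rewrite collapse_m].
Qed.

Lemma image_xplus_lt1 t : c < t < d -> phi (xplus D t) < 1.
Proof.
move=> tcd; have [z [Pz _ zt]] := right_point tcd filterT.
have /andP[_ z1] := phi01 z; apply: lt_le_trans z1.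
by apply: lt_phi => //; [exact: xplusP|rewrite collapse_p].
Qed.

Lemma branch_incr_xminus t : c < t < d ->
  lim_set tau t (phi (xminus D t)) /\
  sigma (xminus D t) = xminus D (phi (xminus D t)).
Proof.
move=> tcd; split.
  apply: at_left_mem => //; have /andP[ct td] := tcd.
  by apply: (phi_left Ddense c0 cd d1 phi_continuous phi_tau) => //; rewrite ct ltW.
apply: xminus_of_lt => U /(left_point tcd)[z [Pz Uz zt]]; exists z => //.
by apply: lt_phi => //; [exact: xminusP|rewrite collapse_m].
Qed.

Lemma branch_incr_xplus t : c < t < d ->
  lim_set tau t (phi (xplus D t)) /\
  sigma (xplus D t) = xplus D (phi (xplus D t)).
Proof.
move=> tcd; split.
  apply: at_right_mem => //; have /andP[ct td] := tcd.
  by apply: (phi_right Ddense c0 cd d1 phi_continuous phi_tau) => //; rewrite td ltW.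
apply: xplus_of_gt => U /(right_point tcd)[z [Pz Uz zt]]; exists z => //.
by apply: lt_phi => //; [exact: xplusP|rewrite collapse_p].
Qed.

(** Only two points t^- < t^+ of one cut need care. If their images lie over the same s, they are
    s^- and s^+. These differ: s is a one-sided limit of [tau] at t in D, so it is in D by closure
    under limits, and it is neither 0 nor 1. *)
Lemma branch_incr x y : P x -> P y -> (x < y)%O -> (sigma x < sigma y)%O.
Proof.
move=> Px Py xy; case: (ltgtP (collapse x) (collapse y)) => [lt_xy|lt_yx|e].
- exact/collapse_lt/lt_phi.
- by have := le_collapse (ltW xy); rewrite leNgt lt_yx.
have [Dt tcd xE yE] := adjacent Px Py xy e.
have [lim_m sm] := branch_incr_xminus tcd.
have [lim_p sp] := branch_incr_xplus tcd.
rewrite xE yE sm sp.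
have := phi_jump Ddense c0 cd d1 phi_continuous phi_tau tau_incr tcd.
rewrite le_eqVlt => /predU1P[e'|lt_s].
  rewrite -e'; apply: xminus_lt_xplus; first exact: lim_setD lim_m.
  by rewrite image_xminus_gt0 // e' image_xplus_lt1.
by apply: collapse_lt; rewrite collapse_xminus ?collapse_xplus.
Qed.

End Increasing.

Section Decreasing.
Hypothesis tau_decr : {in `]c, d[ &, {homo tau : x y /~ x < y}}.

Let phiN_continuous : continuous (fun x => - phi x).
Proof. by move=> x; apply: continuousN; exact: phi_continuous. Qed.

Let phiN_tau r : c < r < d -> ~ D r -> - phi (xminus D r) = - tau r.
Proof. by move=> rcd nDr; congr (- _); exact: phi_tau. Qed.

Let tauN_incr : {in `]c, d[ &, {homo (fun r => - tau r) : x y / x < y}}.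
Proof. by move=> u v ucd vcd uv; rewrite ltrN2; exact: tau_decr. Qed.

Let lt_phi x y : P x -> P y -> collapse x < collapse y -> phi y < phi x.
Proof.
move=> Px Py xy; rewrite -ltrN2.
exact: (phi_incr Ddense c0 cd d1 phiN_continuous phiN_tau tauN_incr).
Qed.

Lemma image_xminus_lt1 t : c < t < d -> phi (xminus D t) < 1.
Proof.
move=> tcd; have [z [Pz _ zt]] := left_point tcd filterT.
have /andP[_ z1] := phi01 z; apply: lt_le_trans z1.
by apply: lt_phi => //; [exact: xminusP|rewrite collapse_m].
Qed.

Lemma image_xplus_gt0 t : c < t < d -> 0 < phi (xplus D t).
Proof.
move=> tcd; have [z [Pz _ zt]] := right_point tcd filterT.
have /andP[z0 _] := phi01 z; apply: le_lt_trans z0 _.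
by apply: lt_phi => //; [exact: xplusP|rewrite collapse_p].
Qed.

(** The increasing case is applied to [- phi] and [- tau]. Reversing the order exchanges the sides,
    so a left point of a cut goes to a right point. *)
Lemma branch_decr_xminus t : c < t < d ->
  lim_set tau t (phi (xminus D t)) /\
  sigma (xminus D t) = xplus D (phi (xminus D t)).
Proof.
move=> tcd; split.
  apply: at_left_mem => //; have /andP[ct td] := tcd.
  apply/cvgNP; apply: (phi_left Ddense c0 cd d1 phiN_continuous phiN_tau) => //.
  by rewrite ct ltW.
apply: xplus_of_gt => U /(left_point tcd)[z [Pz Uz zt]]; exists z => //.
by apply: lt_phi => //; [exact: xminusP|rewrite collapse_m].
Qed.

Lemma branch_decr_xplus t : c < t < d ->
  lim_set tau t (phi (xplus D t)) /\
  sigma (xplus D t) = xminus D (phi (xplus D t)).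
Proof.
move=> tcd; split.
  apply: at_right_mem => //; have /andP[ct td] := tcd.
  apply/cvgNP; apply: (phi_right Ddense c0 cd d1 phiN_continuous phiN_tau) => //.
  by rewrite td ltW.
apply: xminus_of_lt => U /(right_point tcd)[z [Pz Uz zt]]; exists z => //.
by apply: lt_phi => //; [exact: xplusP|rewrite collapse_p].
Qed.

Lemma branch_decr_jump t : c < t < d -> phi (xplus D t) <= phi (xminus D t).
Proof.
move=> tcd; rewrite -lerN2.
exact: (phi_jump Ddense c0 cd d1 phiN_continuous phiN_tau tauN_incr tcd).
Qed.

Lemma branch_decr x y : P x -> P y -> (x < y)%O -> (sigma y < sigma x)%O.
Proof.
move=> Px Py xy; case: (ltgtP (collapse x) (collapse y)) => [lt_xy|lt_yx|e].
- exact/collapse_lt/lt_phi.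
- by have := le_collapse (ltW xy); rewrite leNgt lt_yx.
have [Dt tcd xE yE] := adjacent Px Py xy e.
have [lim_m sm] := branch_decr_xminus tcd.
have [lim_p sp] := branch_decr_xplus tcd.
rewrite xE yE sm sp.
have := branch_decr_jump tcd; rewrite le_eqVlt => /predU1P[e'|lt_s].
  rewrite e'; apply: xminus_lt_xplus; first exact: lim_setD lim_m.
  by rewrite image_xminus_lt1 // andbT -e' image_xplus_gt0.
by apply: collapse_lt; rewrite collapse_xminus ?collapse_xplus.
Qed.

End Decreasing.

Hypothesis tau_mono : {in `]c, d[ &, {homo tau : x y / x < y}} \/
  {in `]c, d[ &, {homo tau : x y /~ x < y}}.

Lemma branch_inj x y : P x -> P y -> sigma x = sigma y -> x = y.
Proof.
move=> Px Py e; case: (ltgtP x y) => // xy; exfalso; case: tau_mono => tm.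
- by have := branch_incr tm Px Py xy; rewrite e ltxx.
- by have := branch_decr tm Px Py xy; rewrite e ltxx.
- by have := branch_incr tm Py Px xy; rewrite e ltxx.
- by have := branch_decr tm Py Px xy; rewrite e ltxx.
Qed.

Lemma sep_piece t x y : P x -> P y -> sep t x y -> c < t < d.
Proof.
move=> Px Py [Dt t01 xt ty]; have lt_t := xminus_lt_xplus Dt t01.
have /andP[t0 t1] := t01; have t01' : 0 <= t <= 1 by rewrite !ltW.
have /andP[cx _] := piece_collapse c0 cd d1 Px.
have /andP[_ yd] := piece_collapse c0 cd d1 Py.
have xt' := le_collapse xt; have ty' := le_collapse ty.
rewrite collapse_xminus // in xt'; rewrite collapse_xplus // in ty'.
move: Px Py; rewrite /= !in_itv /= => /andP[cx' _] /andP[_ yd'].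
apply/andP; split; rewrite lt_neqAle; apply/andP; split.
- apply/eqP => tE; rewrite tE in cx'.
  by have := lt_le_trans lt_t (le_trans cx' xt); rewrite ltxx.
- exact: le_trans cx xt'.
- apply/eqP => tE; rewrite -tE in yd'.
  by have := lt_le_trans lt_t (le_trans ty yd'); rewrite ltxx.
- exact: le_trans ty' yd.
Qed.

(** The map may jump at t, so the cut can have two images. The one determined by t^- is enough: t^-
    goes to one side of the cut at s, and strict monotonicity puts the images of x and y on opposite
    sides. *)
Lemma branch_sep t x y : P x -> P y -> sep t x y ->
  exists s, [/\ lim_set tau t s, s = phi (xminus D t) &
    sep s (sigma x) (sigma y) \/ sep s (sigma y) (sigma x)].
Proof.
move=> Px Py txy; have tcd := sep_piece Px Py txy.
have [Dt t01 xt ty] := txy; have lt_t := xminus_lt_xplus Dt t01.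
have Pm := xminusP tcd; have Pp := xplusP tcd.
exists (phi (xminus D t)); case: tau_mono => tm.
  have [lim_m sm] := branch_incr_xminus tm tcd; split=> //; left.
  have sx : (sigma x <= sigma (xminus D t))%O.
    move: xt; rewrite le_eqVlt => /predU1P[->//|xt].
    by apply: ltW; exact: branch_incr.
  have sy : (sigma (xminus D t) < sigma y)%O.
    by apply: branch_incr => //; exact: lt_le_trans ty.
  rewrite {}sm in sx sy.
  have Ds : D (phi (xminus D t)) by exact: lim_setD lim_m.
  have s01 : 0 < phi (xminus D t) < 1.
    apply/andP; split; first exact: image_xminus_gt0.
    have /andP[_ p1] := phi01 (xplus D t).
    have := phi_jump Ddense c0 cd d1 phi_continuous phi_tau tm tcd.
    by move/le_lt_trans; apply; exact: image_xplus_lt1.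
  by split=> //; rewrite -gt_xminus.
have [lim_m sm] := branch_decr_xminus tm tcd; split=> //; right.
have sx : (sigma (xminus D t) <= sigma x)%O.
  move: xt; rewrite le_eqVlt => /predU1P[->//|xt].
  by apply: ltW; exact: branch_decr.
have sy : (sigma y < sigma (xminus D t))%O.
  by apply: branch_decr => //; exact: lt_le_trans ty.
rewrite {}sm in sx sy.
have Ds : D (phi (xminus D t)) by exact: lim_setD lim_m.
have s01 : 0 < phi (xminus D t) < 1.
  rewrite image_xminus_lt1 // andbT.
  exact: lt_le_trans (image_xplus_gt0 tm tcd) (branch_decr_jump tm tcd).
by split=> //; rewrite -lt_xplus.
Qed.

End Branch.

(** * Markov pieces *)

Section MarkovPieces.
Context {R : realType}.
Variables (D : set R) (q : nat) (b : nat -> R).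
Local Notation X := (disconnection D).
Implicit Types x y : X.
Hypothesis bP : is_partition q b.
Hypothesis bD : forall i, (i <= q)%N -> D (b i).
Local Notation E := (@markov_piece R D b).

Lemma partition01 i : (i <= q)%N -> 0 <= b i <= 1.
Proof.
move=> iq; have [b0 bq _] := bP.
by rewrite -{1}b0 -bq !(partition_le bP).
Qed.

Lemma partition_inner i : (0 < i < q)%N -> 0 < b i < 1.
Proof.
move=> /andP[i0 iq]; have [b0 bq _] := bP.
by rewrite -{1}b0 -bq !(partition_lt bP) // ltnW.
Qed.

Lemma piece_order i j : (0 < i)%N -> (i <= j)%N -> (j < q)%N ->
  (xminus D (b i) < xplus D (b j))%O.
Proof.
move=> i0 ij jq; have [<-|nij] := eqVneq i j.
  by apply: xminus_lt_xplus; [apply: bD; lia|apply: partition_inner; lia].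
have iq : (i <= q)%N by lia.
apply: collapse_lt; rewrite collapse_xminus ?partition01 //.
rewrite collapse_xplus ?partition01 ?(ltnW jq) //.
by apply: (partition_lt bP); [lia|exact: ltnW].
Qed.

Lemma le_pieces i j x y : (i < q)%N -> (j < q)%N -> E i x -> E j y ->
  (x <= y)%O -> (i <= j)%N.
Proof.
rewrite /markov_piece /= !in_itv /= => iq jq /andP[xi _] /andP[_ yj] xy.
rewrite leqNgt; apply/negP => ji.
have := le_lt_trans (le_trans xy yj) (piece_order (ltn0Sn j) ji iq).
by rewrite ltNge xi.
Qed.

Lemma piece_uniq i j x : (i < q)%N -> (j < q)%N -> E i x -> E j x -> i = j.
Proof.
move=> iq jq xi xj; apply/eqP; rewrite eqn_leq.
by rewrite (le_pieces iq jq xi xj (lexx x)) (le_pieces jq iq xj xi (lexx x)).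
Qed.

Lemma piece_cover x : exists i : 'I_q, E i x.
Proof.
have [b0 bq _] := bP; have x01 := collapse_itv x.
(* The ends 0 and 1 are never split, so they give the least and the greatest point of X. *)
have x0 : (xplus D 0 <= x)%O.
  rewrite xplusN; last by rewrite ltxx => -[].
  apply: le_trans (xminus_le x); have /andP[x0 _] := x01.
  move: x0; rewrite (le_eqVlt 0) => /predU1P[<-//|x0].
  by apply: ltW; apply: collapse_lt; rewrite !collapse_xminus // lexx ler01.
have x1 : (x <= xminus D 1)%O.
  rewrite -xplusN; last by rewrite ltxx andbF => -[].
  apply: le_trans (le_xplus x) _; have /andP[_ x1] := x01.
  move: x1; rewrite (le_eqVlt _ 1) => /predU1P[->//|x1].
  by apply: ltW; apply: collapse_lt; rewrite !collapse_xplus // lexx ler01.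
have q0 : (0 < q)%N.
  by rewrite lt0n; apply/eqP => q0; move: (@ltr01 R); rewrite -bq q0 b0 ltxx.
have ex : exists i, (xplus D (b i) <= x)%O && (i < q)%N by exists 0%N; rewrite b0 x0.
have le_q i : (xplus D (b i) <= x)%O && (i < q)%N -> (i <= q)%N.
  by case/andP => _ /ltnW.
case: (ex_maxnP ex le_q) => i /andP[bix iq] imax.
exists (Ordinal iq); rewrite /markov_piece /= in_itv /= bix /=.
have [iq1|] := ltnP i.+1 q; last first.
  by move=> qi; have -> : i.+1 = q by [lia]; rewrite bq.
have [//|bi1] := le_xminusVge_xplus x (partition01 iq).
by have := imax i.+1; rewrite bi1 iq1 ltnn => /(_ isT).
Qed.

Lemma piece_nonempty i : (i < q)%N -> E i (xplus D (b i)).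
Proof.
move=> iq; have [_ _ bS] := bP.
rewrite /markov_piece /= in_itv /= lexx /=.
apply: ltW; apply: collapse_lt.
by rewrite collapse_xplus ?collapse_xminus ?partition01 ?bS // ltnW.
Qed.

Lemma piece_eq i j x y : (i < q)%N -> (j < q)%N -> E i x -> E j y -> (x <= y)%O ->
  (forall k, (k <= q)%N -> ~ sep (b k) x y) -> i = j.
Proof.
move=> iq jq xi yj xy nsep.
have := le_pieces iq jq xi yj xy; rewrite leq_eqVlt => /predU1P[//|ij].
exfalso; apply: (nsep i.+1 iq); move: xi yj; rewrite /markov_piece /= !in_itv /=.
move=> /andP[_ xi] /andP[yj _]; split=> //; [exact: bD|apply: partition_inner; lia|].
apply: le_trans yj; move: ij; rewrite leq_eqVlt => /predU1P[->//|ij].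
apply: ltW; apply: collapse_lt.
by rewrite !collapse_xplus ?partition01 ?(partition_lt bP) // ltnW.
Qed.

Lemma sep_same_piece i k x y : (i < q)%N -> (k <= q)%N -> E i x -> E i y ->
  ~ sep (b k) x y.
Proof.
rewrite /markov_piece /= !in_itv /= => iq kq /andP[xi _] /andP[_ yi] [_ k01 xk ky].
have [b0 bq _] := bP.
have k0 : (0 < k)%N by rewrite lt0n; apply/eqP => k0; move: k01; rewrite k0 b0 ltxx.
have kq' : (k < q)%N.
  by rewrite ltn_neqAle kq andbT; apply/eqP => kE; move: k01; rewrite kE bq ltxx andbF.
have [ki|ik] := leqP k i.
  by have := lt_le_trans (piece_order k0 ki iq) (le_trans xi xk); rewrite ltxx.
have := lt_le_trans (piece_order (ltn0Sn i) ik kq') (le_trans ky yi).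
by rewrite ltxx.
Qed.

Lemma psi_fun_piece (v : 'rV[int]_q) (i : 'I_q) x : E i x -> psi_fun b v x = v 0 i.
Proof.
move=> xi; rewrite /psi_fun (bigD1 i) //= big1 => [|j ji].
  by rewrite indicE mem_set // mulr1 addr0.
rewrite indicE memNset ?mulr0 // => xj; move/eqP: ji; apply.
by apply: val_inj; exact: piece_uniq xj xi.
Qed.

Lemma psi_fun_inj (v w : 'rV[int]_q) :
  psi_fun b v = psi_fun b w :> (X -> int) -> v = w.
Proof.
move=> vw; apply/rowP => i; have xi := piece_nonempty (ltn_ord i).
by rewrite -(psi_fun_piece v xi) vw (psi_fun_piece w xi).
Qed.

Lemma step_psi f : (forall x y, (x <= y)%O ->
    (forall k, (k <= q)%N -> ~ sep (b k) x y) -> f x = f y) ->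
  f = psi_fun b (\row_(i < q) f (xplus D (b i))) :> (X -> int).
Proof.
move=> fb; apply/funext => x; have [i xi] := piece_cover x.
rewrite (psi_fun_piece _ xi) mxE; apply/esym/fb.
  by move: xi; rewrite /markov_piece /= in_itv /= => /andP[].
move=> k kq; apply: (sep_same_piece (ltn_ord i)) => //.
exact: piece_nonempty.
Qed.

End MarkovPieces.

(** * Injectivity and images of sigma on Markov pieces *)

Section MarkovBranches.
Context {R : realType}.
Variables (tau : R -> R) (n : nat) (a : nat -> R).
Hypothesis tau_pm : piecewise_monotonic tau n a.
Local Notation C := (partition_points n a).
Local Notation D := (gen_orbit tau C).
Local Notation X := (disconnection D).
Variables (q : nat) (b : nat -> R).
Hypothesis bM : markov_partition tau C q b.
Variable sigma : X -> X.
Hypothesis sigma_tau : associated_map tau sigma.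
Local Notation E := (@markov_piece R D b).
Implicit Types x y : X.

Let bP : is_partition q b. Proof. by case: bM. Qed.
Let bD i : (i <= q)%N -> D (b i). Proof. by case: bM => _ + _ _ _; apply. Qed.
Let Ddense := orbitN_dense tau_pm bM.
Let sigmac : continuous sigma. Proof. by case: sigma_tau. Qed.
Let sigmaE x : ~ D (collapse x) -> collapse (sigma x) = tau (collapse x).
Proof. by case: sigma_tau => _; apply. Qed.
Let lim_setD t : D t -> lim_set tau t `<=` D. Proof. exact: orbit_lim_set. Qed.
Let bS i : (i < q)%N -> b i < b i.+1. Proof. by case: bP => _ _; apply. Qed.
Let bge0 i : (i < q)%N -> 0 <= b i.
Proof. by move=> /ltnW/(partition01 bP)/andP[]. Qed.
Let ble1 i : (i < q)%N -> b i.+1 <= 1.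
Proof. by move=> /(partition01 bP)/andP[]. Qed.

Lemma dense_nbhs (u : R) W : nbhs u W -> exists2 r, W r & ~ D r.
Proof.
move=> /nbhs_ballP[e /= e0 eW].
have [|r /andP[ur re] nDr] := @Ddense u (u + e); first by rewrite ltrDl.
exists r => //; apply: eW; rewrite /ball /= ltr_distlC re andbT.
by apply: lt_trans ur; rewrite ltrBlDr ltrDl.
Qed.

(** A Markov interval only comes with weak monotonicity and may contain points of C. Equal values at
    u and v would make [tau] constant on [u,v], which overlaps an interval of strict
    monotonicity. *)
Lemma tau_neq i (u v : R) : (i < q)%N -> b i < u -> u < v -> v < b i.+1 ->
  tau u != tau v.
Proof.
move=> iq iu uv vi; apply/eqP => tuv.
have [_ _ bm _ _] := bM; have [_ aP _] := tau_pm.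
have cst w : u <= w <= v -> tau w = tau u.
  move=> /andP[uw wv].
  have wI : w \in `]b i, b i.+1[ by rewrite in_itv /= (lt_le_trans iu uw) (le_lt_trans wv vi).
  have uI : u \in `]b i, b i.+1[ by rewrite in_itv /= iu (lt_trans uv vi).
  have vI : v \in `]b i, b i.+1[ by rewrite in_itv /= vi (lt_trans iu uv).
  apply/eqP; rewrite eq_le; case: (bm i iq) => tm.
    by rewrite {1}tuv !tm.
  by rewrite {2}tuv !tm.
(* A point outside D avoids C, so it lies inside some interval of strict monotonicity; w' is then
   chosen to its right, in that interval and below v. *)
have [w /andP[uw wv] nDw] := Ddense uv.
have w01 : 0 <= w <= 1.
  rewrite (le_trans (bge0 iq)) ?(ltW (lt_trans iu uw)) //=.
  by rewrite (le_trans _ (ble1 iq)) // ltW // (lt_trans wv).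
have nCw : ~ C w by move/orbitC.
have [k kn /andP[kw wk]] := partition_itv_oo aP w01 nCw.
have [|w' /andP[ww' +] _] := @Ddense w (Num.min v (a k.+1)); first by rewrite lt_min wv.
rewrite lt_min => /andP[w'v w'k].
have : w = w'.
  apply: (tau_inj_itv tau_pm kn); rewrite ?kw ?(lt_trans kw ww') //.
  by rewrite !cst // ?(ltW uw) ?(ltW wv) ?(ltW (lt_trans uw ww')) ?(ltW w'v).
by move/eqP; rewrite lt_eqF.
Qed.

Lemma tau_strict i : (i < q)%N ->
  {in `]b i, b i.+1[ &, {homo tau : x y / x < y}} \/
  {in `]b i, b i.+1[ &, {homo tau : x y /~ x < y}}.
Proof.
move=> iq; have [_ _ bm _ _] := bM.
have lt_in u v : u \in `]b i, b i.+1[ -> v \in `]b i, b i.+1[ -> u < v ->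
    tau u != tau v.
  by rewrite !in_itv /= => /andP[iu _] /andP[_ vi] uv; exact: (tau_neq iq).
case: (bm i iq) => tm; [left|right] => u v uI vI uv.
  by rewrite lt_neqAle lt_in // tm // ltW.
by rewrite lt_neqAle eq_sym lt_in // tm // ltW.
Qed.

Lemma sigma_inj_piece i x y : (i < q)%N -> E i x -> E i y -> sigma x = sigma y -> x = y.
Proof.
move=> iq; apply: (branch_inj Ddense sigmac sigmaE lim_setD) => //; last exact: tau_strict.
- exact: bge0.
- exact: bS.
- exact: ble1.
Qed.

Lemma sigma_sep i t x y : (i < q)%N -> E i x -> E i y -> sep t x y ->
  exists2 s, lim_set tau t s /\ s = collapse (sigma (xminus D t)) &
    sep s (sigma x) (sigma y) \/ sep s (sigma y) (sigma x).
Proof.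
move=> iq xi yi txy.
have [s [h1 h2 h3]] := branch_sep Ddense sigmac sigmaE lim_setD (bge0 iq) (bS iq)
  (ble1 iq) (tau_strict iq) xi yi txy.
by exists s.
Qed.

(** The Markov condition describes the image under [tau] only up to closure, and [sigma] follows
    [tau] only over points outside I_1. Both sides here are closed in X, the left one by
    compactness, so each inclusion can be tested on such points. *)
Lemma image_piece i : (i < q)%N -> exists J : set 'I_q,
  sigma @` E i = \bigcup_(j in J) E j.
Proof.
move=> iq; have [_ _ _ /(_ i iq)[J JE] _] := bM; exists J.
have cE j : closed (E j) by exact: closed_piece.
apply/seteqP; split=> [_ [x xi <-]|y [j Jj yj]].
  have cJ : closed (\bigcup_(j in J) E j).
    by apply: closed_bigcup => //; exact: finite_finset.
  apply: contrapT => nJ.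
  have nS : nbhs (sigma x) (~` \bigcup_(j in J) E j).
    by apply: open_nbhs_nbhs; split=> //; exact: closed_openC.
  have [r [rI nDr nr]] :=
    piece_nbhs Ddense (bge0 iq) (bS iq) (ble1 iq) xi (sigmac nS).
  have /andP[r1 r2] := rI.
  have r01 : 0 <= r <= 1.
    by rewrite (le_trans (bge0 iq)) ?(ltW r1) // (le_trans _ (ble1 iq)) // ltW.
  suff : (\bigcup_(j in J) E j) (sigma (xminus D r)) by exact: nr.
  have : closure (tau @` `]b i, b i.+1[) (tau r).
    by apply: subset_closure; exists r.
  rewrite JE => -[j Jj]; rewrite /= in_itv /= => /andP[jr rj]; exists j => //.
  have nDt := tau_not_orbit tau_pm r01 nDr.
  have jq := ltn_ord j.
  apply: (piece_mem (bge0 jq) (bS jq) (ble1 jq)).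
  rewrite sigmaE collapse_xminus // !lt_neqAle jr rj !andbT.
  by apply/andP; split; apply/eqP => e; apply: nDt;
    [rewrite -e|rewrite e]; apply: bD => //; exact: ltnW.
have cpt : compact (sigma @` E i).
  apply: continuous_compact; first by apply: continuous_subspaceT.
  by apply: (subclosed_compact (cE i) (@compact_disconnection R D)).
have cl : closed (sigma @` E i) := compact_closed order_hausdorff cpt.
apply: contrapT => nS.
have jq := ltn_ord j.
have nU : nbhs y (~` (sigma @` E i)).
  by apply: open_nbhs_nbhs; split=> //; exact: closed_openC.
(* With the interior, the approximating point r comes with a whole neighbourhood missed by the
   image. As r is not split, that neighbourhood contains everything over an interval around r. *)
have nU' : nbhs y ((~` (sigma @` E i))^°).
  by apply: open_nbhs_nbhs; split; [exact: open_interior|exact: nU].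
have [r [rJ nDr nr]] := piece_nbhs Ddense (bge0 jq) (bS jq) (ble1 jq) yj nU'.
have /andP[r1 r2] := rJ.
have r01 : 0 <= r <= 1.
  by rewrite (le_trans (bge0 jq)) ?(ltW r1) // (le_trans _ (ble1 jq)) // ltW.
have rE : xplus D r = xminus D r by rewrite xplusN // => -[].
have [e1 e10 h1] := nbhs_xminus r01 nr.
rewrite -rE in nr; have [e2 e20 h2] := nbhs_xplus r01 nr.
have hU z : r - e1 < collapse z -> collapse z < r + e2 -> ~ (sigma @` E i) z.
  move=> z1 z2; have [zl|zr] := le_xminusVge_xplus z r01; first exact: h1.
  exact: h2.
(* A value of [tau] in that interval is wanted at a point where [tau] is continuous, so that the
   point can be moved outside I_1. Avoiding the values on C ensures this. *)
have cC : countable (tau @` C).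
  by apply/finite_set_countable/finite_image/finite_partition_points.
pose l := Num.max (b j) (r - e1); pose u := Num.min (b j.+1) (r + e2).
have lr : l < r by rewrite gt_max r1 ltrBlDr ltrDl.
have ru : r < u by rewrite lt_min r2 ltrDl.
have [r' /andP[lr' ru'] nCr'] := not_countable_itv cC (lt_trans lr ru).
have clr' : closure (tau @` `]b i, b i.+1[) r'.
  rewrite JE; exists j => //; rewrite /= in_itv /=.
  move: lr' ru'; rewrite gt_max lt_min => /andP[/ltW -> _] /andP[/ltW -> _].
  by [].
have nW : nbhs r' (`]l, u[%classic `&` ~` (tau @` C)).
  apply: open_nbhs_nbhs; split; last by rewrite /= in_itv /= lr' ru'.
  apply: openI; first exact: itv_open.
  apply: closed_openC; apply: compact_closed; first exact: norm_hausdorff.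
  by apply: finite_compact; apply/finite_image/finite_partition_points.
have [_ [[w wI <-] [+ nCw]]] := clr' _ nW.
rewrite /= !in_itv /= in wI * => /andP[lw wu].
have /andP[w1 w2] := wI.
have w01 : 0 <= w <= 1.
  by rewrite (le_trans (bge0 iq)) ?(ltW w1) // (le_trans _ (ble1 iq)) // ltW.
have ct : tau z @[z --> w] --> tau w.
  by apply: (tau_continuous tau_pm w01) => Cw; apply: nCw; exists w.
have : nbhs w ([set z | l < tau z] `&` [set z | tau z < u] `&` `]b i, b i.+1[%classic).
  apply: filterI; last first.
    by apply: open_nbhs_nbhs; split; [exact: itv_open|rewrite /= in_itv].
  by apply: filterI; [exact: (cvgr_gt _ ct)|exact: (cvgr_lt _ ct)].
case/dense_nbhs => s [[ls su] sI] nDs; rewrite /= in_itv /= in sI.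
have /andP[s1 s2] := sI.
have s01 : 0 <= s <= 1.
  by rewrite (le_trans (bge0 iq)) ?(ltW s1) // (le_trans _ (ble1 iq)) // ltW.
have tE : collapse (sigma (xminus D s)) = tau s by rewrite sigmaE collapse_xminus.
apply: (hU (sigma (xminus D s))); rewrite ?tE.
- by move: ls; rewrite /= /l gt_max => /andP[].
- by move: su; rewrite /= /u lt_min => /andP[].
- exists (xminus D s) => //; apply: (piece_mem (bge0 iq) (bS iq) (ble1 iq)).
  by rewrite collapse_xminus.
Qed.

Lemma image_piece_sub i j x : (i < q)%N -> (j < q)%N -> E j x ->
  (sigma @` E i) x -> E j `<=` sigma @` E i.
Proof.
move=> iq jq xj; have [J ->] := image_piece iq; move=> [k Jk xk].
by rewrite (piece_uniq bP bD jq (ltn_ord k) xj xk) => y yk; exists k.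
Qed.

End MarkovBranches.

(** * The transfer map *)

(** L is linear over functions pulled back along [sigma], which are constant on fibres. This is what
    allows a preimage under L to be cut down to a chosen piece. *)
Lemma transfer_mulr (X : topologicalType) (sigma : X -> X) (f h : X -> int) :
  transfer sigma (fun y => f y * h (sigma y)) = (fun x => transfer sigma f x * h x).
Proof.
apply/funext => x; rewrite /transfer mulr_suml.
have [fin|nfin] := pselect (finite_set (sigma @^-1` [set x])); last first.
  (* Over an infinite fibre both sums are empty by the default value of [fset_set]. *)
  by rewrite /fset_set; case: pselect => // _; rewrite !big_nil.
by apply: eq_big_seq => y; rewrite in_fset_set // inE => /= ->.
Qed.

Lemma iter_transfer_mulr (X : topologicalType) (sigma : X -> X) (f h : X -> int) k :
  iter k (transfer sigma) (fun y => f y * h (iter k sigma y)) =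
  (fun x => iter k (transfer sigma) f x * h x).
Proof.
elim: k f h => [//|k IH] f h; rewrite iterS.
by rewrite (IH f (h \o sigma)) -transfer_mulr.
Qed.

Lemma transfer_ge0 (X : topologicalType) (sigma : X -> X) (f : X -> int) k :
  (forall x, 0 <= f x) -> forall x, 0 <= iter k (transfer sigma) f x.
Proof. by move=> f0; elim: k => [//|k IH] x; apply: sumr_ge0 => y _; exact: IH. Qed.

Section MarkovTransfer.
Context {R : realType}.
Variables (tau : R -> R) (n : nat) (a : nat -> R).
Hypothesis tau_pm : piecewise_monotonic tau n a.
Local Notation C := (partition_points n a).
Local Notation D := (gen_orbit tau C).
Local Notation X := (disconnection D).
Variables (q : nat) (b : nat -> R).
Hypothesis bM : markov_partition tau C q b.
Variable sigma : X -> X.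
Hypothesis sigma_tau : associated_map tau sigma.
Local Notation E := (@markov_piece R D b).
Local Notation A := (incidence sigma q b).
Local Notation L := (transfer sigma).
Implicit Types x y : X.

Let bP : is_partition q b. Proof. by case: bM. Qed.
Let bD i : (i <= q)%N -> D (b i). Proof. by case: bM => _ + _ _ _; apply. Qed.

(** The inverse of [sigma] on the i-th piece, undefined off its image. *)
Let branch (i : 'I_q) x : option X :=
  if pselect (exists y, E i y /\ sigma y = x) is left h then Some (projT1 (cid h))
  else None.

Let branchP i x y : branch i x = Some y <-> E i y /\ sigma y = x.
Proof.
rewrite /branch; case: pselect => [h|nh]; last first.
  by split=> // yx; exfalso; apply: nh; exists y.
have [h1 h2] := projT2 (cid h); split=> [[<-]//|[yi yx]]; congr Some.
by apply: (sigma_inj_piece tau_pm bM sigma_tau (ltn_ord i)); rewrite // yx.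
Qed.

(** Each piece holds at most one point of the fibre, so fibres are finite and the default of
    [fset_set] never interferes. *)
Lemma transfer_branches f x : L f x = \sum_(i < q) oapp f 0 (branch i x).
Proof.
pose s := pmap (branch^~ x) (enum 'I_q).
(* The piece of a preimage recovers the branch it came from, so the list [s] has no repetitions. *)
pose idx y : 'I_q := projT1 (cid (piece_cover bP y)).
have branchK : ocancel (branch^~ x) idx.
  move=> i; case br : (branch i x) => [y|//] /=.
  have [yi _] := (branchP i x y).1 br; apply: val_inj.
  by apply: (piece_uniq bP bD _ _ (projT2 (cid (piece_cover bP y))) yi).
have ms y : (y \in s) = (y \in sigma @^-1` [set x]).
  rewrite mem_pmap; apply/mapP/idP => [[i _ /esym/branchP[_ yx]]|]; first by rewrite inE.
  rewrite inE => /= yx; have [i yi] := piece_cover bP y.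
  by exists i; [rewrite mem_enum|apply/esym/branchP].
have fin : finite_set (sigma @^-1` [set x]).
  apply: (sub_finite_set _ (finite_seq s)) => y yx.
  by rewrite /= ms inE.
rewrite /transfer (perm_big s).
  by rewrite big_pmap big_enum.
apply: uniq_perm => [||y]; first exact: finmap.fset_uniq.
  by apply: (pmap_uniq branchK); exact: enum_uniq.
by rewrite ms in_fset_set.
Qed.

(** The image of a piece contains or misses each piece, so at a point of the j-th piece the i-th
    branch is defined exactly when the (i,j) entry of A is 1. *)
Lemma transfer_psi (v : 'rV[int]_q) :
  L (psi_fun b v) = psi_fun b (v *m A) :> (X -> int).
Proof.
apply/funext => x; have [j xj] := piece_cover bP x.
rewrite transfer_branches (psi_fun_piece bP bD _ xj) mxE.
apply: eq_bigr => i _; rewrite mxE.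
case br : (branch i x) => [y|] /=.
  have [yi yx] := (branchP i x y).1 br.
  rewrite (psi_fun_piece bP bD _ yi) asboolT ?mulr1 //.
  apply: (image_piece_sub tau_pm bM sigma_tau (ltn_ord i) (ltn_ord j) xj).
  by exists y.
rewrite asboolF ?mulr0 // => /(_ _ xj)[y yi yx].
by have := (branchP i x y).2 (conj yi yx); rewrite br.
Qed.

Lemma iter_transfer_psi (v : 'rV[int]_q) k :
  iter k L (psi_fun b v) = psi_fun b (v *m A ^+ k) :> (X -> int).
Proof.
elim: k => [|k IH]; first by rewrite expr0 mulmx1.
by rewrite iterS IH transfer_psi exprSr -mulmxA.
Qed.

(** The index k bounds the number of transfers after which only Markov cuts remain as jumps. *)
Definition steps k (f : X -> int) :=
  exists2 F : seq R, step F f & forall t, t \in F -> landing tau q b k t.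

(** If x and y lie in one piece, the same branches are defined at both. If f differs at the two
    preimages on some branch, one of its jumps separates them, and by [sigma_sep] the image of that
    cut separates x from y. *)
Lemma steps_transfer k f : steps k.+1 f -> steps k (L f).
Proof.
move=> [F Ff Fk].
(* The Markov points keep x and y in one piece. The filter is harmless: a cut t of F separating two
   points of a piece has as image a genuine limit of [tau] at t, which lies in [landing k]. *)
pose F' := [seq collapse (sigma (xminus D t)) | t <- F] ++ [seq b i | i <- iota 0 q.+1].
exists [seq s <- F' | `[< landing tau q b k s >]]; last first.
  by move=> t; rewrite mem_filter => /andP[/asboolP].
move=> x y xy nsep.
have nsepF s : s \in F' -> landing tau q b k s -> ~ sep s x y.
  by move=> sF sk; apply: nsep; rewrite mem_filter sF andbT; apply/asboolP.
have nsepb i : (i <= q)%N -> ~ sep (b i) x y.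
  move=> iq; apply: nsepF.
    by rewrite mem_cat; apply/orP; right; apply: map_f; rewrite mem_iota.
  by apply: (landing_le bM (leq0n k)); exists i.
have [j xj] := piece_cover bP x; have [j' yj'] := piece_cover bP y.
have jj' : j = j'.
  apply: val_inj.
  exact: (piece_eq bP bD (ltn_ord j) (ltn_ord j') xj yj' xy nsepb).
have yj : E j y by rewrite jj'.
have nsepyx s : ~ sep s y x.
  move=> [Ds s01 ys sx]; have := xminus_lt_xplus Ds s01.
  by rewrite ltNge (le_trans sx (le_trans xy ys)).
have key (i : 'I_q) u w : E i u -> E i w -> (u <= w)%O ->
    (sigma u = x /\ sigma w = y) \/ (sigma u = y /\ sigma w = x) -> f u = f w.
  move=> ui wi uw e; apply: Ff => // t tF tuw.
  have [s [st sE]] := sigma_sep tau_pm bM sigma_tau (ltn_ord i) ui wi tuw.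
  have sF : s \in F'.
    by rewrite mem_cat sE; apply/orP; left; apply: (map_f (fun t => collapse _)).
  have sk : landing tau q b k s by exact: (Fk t tF).
  by case: e => -[-> ->] [h|h]; ((by apply: (nsepyx s)) || (by apply: (nsepF s))).
rewrite !transfer_branches; apply: eq_bigr => i _.
case bx : (branch i x) => [u|]; last first.
  case by_ : (branch i y) => [w|//]; exfalso.
  have [wi wy] := (branchP i y w).1 by_.
  have [u ui ux] : (sigma @` E i) x.
    by apply: (image_piece_sub tau_pm bM sigma_tau (ltn_ord i) (ltn_ord j) yj) => //; exists w.
  by have := (branchP i x u).2 (conj ui ux); rewrite bx.
have [ui ux] := (branchP i x u).1 bx.
have [w wi wy] : (sigma @` E i) y.
  by apply: (image_piece_sub tau_pm bM sigma_tau (ltn_ord i) (ltn_ord j) xj) => //; exists u.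
rewrite ((branchP i y w).2 (conj wi wy)) /=.
have [uw|wu] := leP u w; first by apply: (key i) => //; left.
by apply/esym/(key i) => //; [exact: ltW|right].
Qed.

Lemma CZ_steps (f : CZ X) : exists k, steps k f.
Proof.
have [F Ff] := CZ_step f.
pose F' := [seq t <- F | `[< D t >]].
have Ff' : step F' f.
  by apply: step_sub Ff => t Dt tF; rewrite mem_filter tF andbT; apply/asboolP.
have F'D t : t \in F' -> D t by rewrite mem_filter => /andP[/asboolP].
have [k hk] : exists k, forall t, t \in F' -> landing tau q b k t.
  elim: F' F'D {Ff'} => [|t s IH] sD; first by exists 0%N.
  have [t' t's|k hk] := IH; first by apply: sD; rewrite inE t's orbT.
  have [_ [l _ tl]] : (unitI `&` \bigcup_k landing tau q b k) t.
    by apply: (orbit_landing tau_pm bM); apply: sD; rewrite mem_head.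
  exists (maxn k l) => t'; rewrite inE => /predU1P[->|/hk].
    exact: (landing_le bM (leq_maxr k l) tl).
  exact: (landing_le bM (leq_maxl k l)).
by exists k, F'.
Qed.

Lemma steps_le k l f : (k <= l)%N -> steps k f -> steps l f.
Proof.
by move=> kl [F Ff Fk]; exists F => // t /Fk; apply: (landing_le bM kl).
Qed.

Lemma transfer_continuous (f : CZ X) : continuous (L f).
Proof.
have [k fk] := CZ_steps f; have [F Ff _] := steps_transfer (steps_le (leqnSn k) fk).
by apply: locally_cst_continuous => x; exact: step_near Ff.
Qed.

Lemma iter_transfer_steps k f : steps k f -> steps 0 (iter k L f).
Proof.
elim: k f => [//|k IH] f fk; rewrite iterSr; apply: IH.
exact: steps_transfer.
Qed.

Lemma iter_transfer_eq_psi (f : CZ X) :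
  exists k (v : 'rV[int]_q), iter k L f = psi_fun b v.
Proof.
have [k fk] := CZ_steps f; have [F Ff F0] := iter_transfer_steps fk.
exists k; eexists; apply: (step_psi bP bD) => x y xy nsep; apply: Ff => // t /F0.
by move=> [i iq <-]; exact: nsep.
Qed.

End MarkovTransfer.

(** * The dimension group *)

Lemma additive_of_morph (U V : zmodType) (f : U -> V) :
  {morph f : x y / x + y} -> exists g : {additive U -> V}, g =1 f.
Proof.
move=> fD; have f0 : f 0 = 0 by apply: (addrI (f 0)); rewrite -fD !addr0.
have fB : zmod_morphism f.
  move=> x y; rewrite fD; congr (_ + _); apply: (addrI (f y)).
  by rewrite -fD !subrr.
by exists (HB.pack_for {additive U -> V} f (GRing.isZmodMorphism.Build U V f fB)).
Qed.

Lemma iter_cancel (T : Type) (f g : T -> T) k :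
  cancel f g -> cancel (iter k f) (iter k g).
Proof. by move=> fK; elim: k => [//|k IH] x; rewrite iterSr iterS fK. Qed.

Lemma iter_transfer_sum (X : topologicalType) (sigma : X -> X) (I : finType)
    (c : I -> int) (g : I -> X -> int) k :
  iter k (transfer sigma) (fun x => \sum_i c i * g i x) =
  (fun x => \sum_i c i * iter k (transfer sigma) (g i) x).
Proof.
elim: k => [//|k IH]; rewrite iterS IH; apply/funext => x.
rewrite /transfer exchange_big /=; apply: eq_bigr => i _.
by rewrite mulr_sumr.
Qed.

(* N consists of the indices that end paths of every length: the sets of ends of
   paths of length m decrease with m and are stationary from m = q on. *)
Lemma stable_support q (A : 'M[int]_q) : exists N : {set 'I_q},
  (forall j, j \in N -> exists2 i, i \in N & A i j != 0) /\
  (forall (v : 'rV[int]_q) j, (v *m A ^+ #|'I_q|) 0 j != 0 -> j \in N).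
Proof.
pose P (S : {set 'I_q}) := [set j | [exists i in S, A i j != 0]]%SET.
have Pmono : {homo P : S T / S \subset T}.
  move=> S T /fintype.subsetP ST; apply/fintype.subsetP => j; rewrite !inE.
  by move=> /exists_inP[i /ST iT ij]; apply/exists_inP; exists i.
exists (finset.cofixset P); split=> [j|v j].
  by rewrite -{1}(cofixsetK Pmono) inE => /exists_inP[i iN ij]; exists i.
(* The greatest fixed point is defined by iterating on complements from the empty set; undoing the
   complements gives q iterations of P from the full set. *)
have -> : finset.cofixset P = iter #|'I_q| P [set: 'I_q]%SET.
  rewrite /finset.cofixset /finset.fixset; elim: #|_| => [|m IH].
    by rewrite finset.setC0.
  by rewrite !iterS /finset.funsetC finset.setCK IH.
elim: #|_| v j => [|m IH] v j; first by rewrite inE.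
rewrite exprSr mulmxA mxE => vj; rewrite iterS inE.
have [i ij] : exists i, (v *m A ^+ m) 0 i * A i j != 0.
  apply/existsP; apply: contraNT vj => /existsPn h; rewrite big1 // => i _.
  by apply/eqP; have := h i; rewrite negbK.
apply/exists_inP; exists i; first by apply: (IH v); apply: contraNneq ij => ->; rewrite mul0r.
by apply: contraNneq ij => ->; rewrite mulr0.
Qed.

Section MarkovDimensionGroup.
Context {R : realType}.
Variables (tau : R -> R) (n : nat) (a : nat -> R).
Hypothesis tau_pm : piecewise_monotonic tau n a.
Local Notation C := (partition_points n a).
Local Notation D := (gen_orbit tau C).
Local Notation X := (disconnection D).
Variables (q : nat) (b : nat -> R).
Hypothesis bM : markov_partition tau C q b.
Variable sigma : X -> X.
Hypothesis sigma_tau : associated_map tau sigma.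
Local Notation E := (@markov_piece R D b).
Local Notation A := (incidence sigma q b).
Local Notation L := (transfer sigma).
Local Notation cl := (dg_class sigma).
Implicit Types (v w : 'rV[int]_q).

Let bP : is_partition q b. Proof. by case: bM. Qed.
Let bD i : (i <= q)%N -> D (b i). Proof. by case: bM => _ + _ _ _; apply. Qed.

Lemma psi_fun_ge0 (v : 'rV[int]_q) :
  (forall x, 0 <= (psi_fun b v : X -> int) x) <-> (forall i, 0 <= v 0 i).
Proof.
split=> [v0 i|v0 x].
  have xi := piece_nonempty D bP (ltn_ord i) : E i (xplus D (b i)).
  by rewrite -(psi_fun_piece bP bD v xi).
have [i xi] := piece_cover bP x.
by rewrite (psi_fun_piece bP bD v xi).
Qed.

Lemma psi_fun_delta (v : 'rV[int]_q) (x : X) :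
  psi_fun b v x = \sum_(j < q) v 0 j * psi_fun b (delta_mx 0 j : 'rV[int]_q) x.
Proof.
have [i xi] := piece_cover bP x.
rewrite (psi_fun_piece bP bD v xi) (bigD1 i) //= big1 => [|j ji].
  by rewrite (psi_fun_piece bP bD _ xi) mxE !eqxx mulr1 addr0.
by rewrite (psi_fun_piece bP bD _ xi) mxE eqxx eq_sym (negbTE ji) mulr0.
Qed.

(* Following a path of length k that ends at j backwards, pull the indicator of
   the j-th piece back through sigma^k inside one injectivity domain. *)
Lemma piece_ancestor (N : {set 'I_q}) k j :
  (forall j, j \in N -> exists2 i, i \in N & A i j != 0) -> j \in N ->
  exists g : CZ X, (forall x, 0 <= g x) /\
    iter k L g = psi_fun b (delta_mx 0 j : 'rV[int]_q).
Proof.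
move=> Npred; have delta_ge0 l (x : X) : 0 <= psi_fun b (delta_mx 0 l : 'rV[int]_q) x.
  by move: x; apply/psi_fun_ge0 => i; rewrite mxE.
elim: k j => [|k IH] j jN.
  by exists (psi bM (delta_mx 0 j)); split=> //; exact: delta_ge0.
have [i iN ij] := Npred j jN; have [g [g0 gE]] := IH i iN.
pose h : CZ X := psi bM (delta_mx 0 j).
have iter_continuous m : continuous (iter m sigma).
  elim: m => [|m IHm] x; first exact: cvg_id.
  by apply: (continuous_comp (IHm x)); case: sigma_tau => + _; apply.
have g'c : continuous (fun x => g x * h (iter k.+1 sigma x)).
  apply: locally_cst_continuous => x.
  have h_near : \forall y \near x, h (iter k.+1 sigma y) = h (iter k.+1 sigma x).
    exact: (iter_continuous k.+1 x _ (CZ_locally_cst h (iter k.+1 sigma x))).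
  by move: (CZ_locally_cst g x) h_near; apply: filterS2 => y -> ->.
exists (mkCZ g'c); split=> [x|]; first by apply: mulr_ge0; [exact: g0|exact: delta_ge0].
have -> : iter k.+1 L (mkCZ g'c) = (fun x => iter k.+1 L g x * h x).
  exact: iter_transfer_mulr.
(* One more transfer spreads the i-th indicator over all pieces in its image; the factor [h] keeps
   only the j-th, with coefficient 1. *)
rewrite iterS gE (transfer_psi tau_pm bM sigma_tau); apply/funext => x.
have [l xl] := piece_cover bP x.
have hE : h x = (delta_mx 0 j : 'rV[int]_q) 0 l by exact: psi_fun_piece.
rewrite hE !(psi_fun_piece bP bD _ xl) -rowE !mxE eqxx /=.
have [->|] := eqVneq l j; last by rewrite mulr0.
by move: ij; rewrite mxE; case: asboolP.
Qed.

Lemma stable_preimage (N : {set 'I_q}) k (v : 'rV[int]_q) :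
  (forall j, j \in N -> exists2 i, i \in N & A i j != 0) ->
  (forall j, v 0 j != 0 -> j \in N) ->
  exists g : CZ X, iter k L g = psi_fun b v /\
    ((forall j, 0 <= v 0 j) -> forall x, 0 <= g x).
Proof.
move=> Npred vN.
have /choice[g gP] : forall j : 'I_q, exists g : CZ X, (forall x, 0 <= g x) /\
    (j \in N -> iter k L g = psi_fun b (delta_mx 0 j : 'rV[int]_q)).
  (* Indices outside N receive a dummy preimage; their coefficients in v vanish. *)
  move=> j; have [jN|jN] := boolP (j \in N); last by exists 0.
  by have [g [g0 gE]] := piece_ancestor k Npred jN; exists g.
have gc : continuous (fun x => \sum_(j < q) v 0 j * g j x).
  apply: locally_cst_continuous => x.
  have near_j (j : 'I_q) : \forall y \near x, g j y = g j x by exact: CZ_locally_cst.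
  have near_all : \forall y \near x, forall j : 'I_q, g j y = g j x.
    exact: filter_forall near_j.
  by move: near_all; apply: filterS => y e; apply: eq_bigr => j _; rewrite e.
exists (mkCZ gc); split; last first.
  by move=> v0 x; apply: sumr_ge0 => j _; apply: mulr_ge0 => //; have [+ _] := gP j; apply.
have -> : iter k L (mkCZ gc) = (fun x => \sum_(j < q) v 0 j * iter k L (g j) x).
  exact: iter_transfer_sum.
apply/funext => x; rewrite psi_fun_delta; apply: eq_bigr => j _.
have [->|/vN jN] := eqVneq (v 0 j) 0; first by rewrite !mul0r.
by have [_ ->] := gP j.
Qed.

(** After k transfers f becomes a row vector, and q further ones push its support into N, where
    preimages of every order exist. If f >= 0, that vector is nonnegative too, and so is the
    preimage. *)
Lemma transfer_onto (f : CZ X) : exists g : CZ X,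
  (exists m, iter m L f = iter m L (L g)) /\
  ((forall x, 0 <= f x) -> forall x, 0 <= g x).
Proof.
have [k [v fE]] := iter_transfer_eq_psi tau_pm bM sigma_tau f.
have [N [Npred Nsupp]] := stable_support A.
(* One order more than was applied to f, so that L g, rather than g, is equivalent to f. *)
have [g [gE g0]] := stable_preimage (k + #|'I_q|).+1 Npred (Nsupp v).
have fE' : iter (k + #|'I_q|) L f = psi_fun b (v *m A ^+ #|'I_q|).
  by rewrite addnC iterD fE (iter_transfer_psi tau_pm bM sigma_tau).
exists g; split; first by exists (k + #|'I_q|)%N; rewrite fE' -gE iterSr.
move=> f0; apply: g0; apply/psi_fun_ge0 => x; rewrite -fE'.
exact: transfer_ge0.
Qed.

Definition transferCZ (f : CZ X) : CZ X :=
  mkCZ (transfer_continuous tau_pm bM sigma_tau (f := f)).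

Lemma iter_transferCZ k f : CZ_fun (iter k transferCZ f) = iter k L f.
Proof. by elim: k => [//|k IH]; rewrite !iterS -IH. Qed.

Lemma dg_class_surj (x : DG sigma) : exists f, x = cl f.
Proof. by exists (repr x); rewrite /dg_class reprK. Qed.

Lemma transfer_star_exists : exists Lstar : {additive DG sigma -> DG sigma},
  forall f : CZ X, Lstar (cl f) = cl (transferCZ f).
Proof.
pose Ls (x : DG sigma) := cl (transferCZ (repr x)).
have LsE f : Ls (cl f) = cl (transferCZ f).
  have /dg_classP[m e] : cl (repr (cl f)) = cl f by rewrite /dg_class reprK.
  by apply/dg_classP; exists m; rewrite -!iterSr !iterS e.
have LsD : {morph Ls : x y / x + y}.
  move=> x y; have [f ->] := dg_class_surj x; have [g ->] := dg_class_surj y.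
  rewrite -dg_classD !LsE -dg_classD; congr cl; apply: CZ_fun_inj.
  exact: (iter_transferD sigma 1).
by have [g gE] := additive_of_morph LsD; exists g => f; rewrite gE.
Qed.

(** Injectivity is built into the equivalence: L f ~ L g after m steps means f ~ g after m + 1.
    Surjectivity and positivity of the inverse come from [transfer_onto]. *)
Lemma transfer_star_inverse (Lstar : {additive DG sigma -> DG sigma}) :
  (forall f : CZ X, Lstar (cl f) = cl (transferCZ f)) ->
  exists Linv : {additive DG sigma -> DG sigma},
    [/\ cancel Lstar Linv, cancel Linv Lstar &
      forall x : DG sigma, DG_pos x -> DG_pos (Linv x)].
Proof.
move=> LE.
have onto f : exists g, Lstar (cl g) = cl f /\ ((forall x, 0 <= f x) -> forall x, 0 <= g x).
  have [g [[m e] g0]] := transfer_onto f; exists g; split=> //.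
  by rewrite LE; apply/dg_classP; exists m.
have Linj : injective Lstar.
  move=> x y; have [f ->] := dg_class_surj x; have [g ->] := dg_class_surj y.
  by rewrite !LE => /dg_classP[m e]; apply/dg_classP; exists m.+1; rewrite !iterSr.
have /choice[Li LiK] : forall x, exists y, Lstar y = x.
  by move=> x; have [f ->] := dg_class_surj x; have [g [gE _]] := onto f; exists (cl g).
have LK : cancel Lstar Li by move=> x; apply: Linj; rewrite LiK.
have LiD : {morph Li : x y / x + y}.
  by move=> x y; apply: Linj; rewrite raddfD !LiK.
have [Linv LinvE] := additive_of_morph LiD.
exists Linv; split=> x; rewrite ?LinvE //.
move=> [f [f0 ->]]; have [g [<- g0]] := onto f.
by rewrite LK; exists g; split=> //; exact: g0.
Qed.

(** * The isomorphism from the inductive limit *)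

Section Isomorphism.
Variables Lstar Linv : {additive DG sigma -> DG sigma}.
Hypothesis LE : forall f : CZ X, Lstar (cl f) = cl (transferCZ f).
Hypotheses (LK : cancel Lstar Linv) (LinvK : cancel Linv Lstar).
Hypothesis Linv_pos : forall x : DG sigma, DG_pos x -> DG_pos (Linv x).

Let iterLE k f : iter k Lstar (cl f) = cl (iter k transferCZ f).
Proof. by elim: k => [//|k IH]; rewrite !iterS IH LE. Qed.

Let iterLpsi k v : iter k Lstar (cl (psi bM v)) = cl (psi bM (v *m A ^+ k)).
Proof.
rewrite iterLE; congr cl; apply: CZ_fun_inj; rewrite iter_transferCZ.
exact: iter_transfer_psi.
Qed.

Let Phi_fun (x : GA A) := iter (repr x).2 Linv (cl (psi bM (repr x).1)).

(** The counterpart in DG of [v,k] = [vA^j,k+j]. Bringing classes to a common exponent by it yields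
    independence of the representative, additivity and injectivity. *)
Let psi_shift k j v : iter k Linv (cl (psi bM v)) =
  iter (k + j) Linv (cl (psi bM (v *m A ^+ j))).
Proof. by rewrite -iterLpsi iterD (iter_cancel j LK). Qed.

Let Phi_funE v k : Phi_fun (ga_class A v k) = iter k Linv (cl (psi bM v)).
Proof.
rewrite /Phi_fun; set x := repr _.
have /ga_classP[l e] : ga_class A x.1 x.2 = ga_class A v k.
  by rewrite -ga_classE reprK.
rewrite (psi_shift x.2 (k + l)) (psi_shift k (x.2 + l)) e.
by congr (iter _ _ _); lia.
Qed.

Let ga_class_surj (x : GA A) : exists v k, x = ga_class A v k.
Proof. by exists (repr x).1, (repr x).2; rewrite -ga_classE reprK. Qed.

Let psiD (v w : 'rV[int]_q) : psi bM (v + w) = psi bM v + psi bM w.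
Proof.
apply: CZ_fun_inj; apply/funext => x; rewrite CZ_addE /=.
have [i xi] := piece_cover bP x.
rewrite /CZ_fun /= !(psi_fun_piece bP bD _ xi).
by rewrite mxE.
Qed.

Let iterLinvD k : {morph iter k Linv : x y / x + y}.
Proof. by elim: k => [//|k IH] x y; rewrite !iterS IH raddfD. Qed.

Let Phi_funD : {morph Phi_fun : x y / x + y}.
Proof.
move=> x y; have [v [k ->]] := ga_class_surj x; have [w [m ->]] := ga_class_surj y.
rewrite ga_classD !Phi_funE psiD dg_classD iterLinvD.
by rewrite (psi_shift k m) (psi_shift m k) (addnC m).
Qed.

Let Phi_fun_inj : injective Phi_fun.
Proof.
move=> x y; have [v [k ->]] := ga_class_surj x; have [w [m ->]] := ga_class_surj y.
rewrite !Phi_funE (psi_shift k m) (psi_shift m k) (addnC m).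
move=> /(can_inj (iter_cancel _ LinvK)) /dg_classP[l].
rewrite !(iter_transfer_psi tau_pm bM sigma_tau) => /(psi_fun_inj bP bD) e.
by apply/ga_classP; exists l; rewrite !exprD !mulmxA.
Qed.

(** Some L^k f is a row vector v, and then [f] = L_*^{-k}[psi v]. *)
Let Phi_fun_surj (y : DG sigma) : exists x, Phi_fun x = y.
Proof.
have [f ->] := dg_class_surj y.
have [k [v fE]] := iter_transfer_eq_psi tau_pm bM sigma_tau f.
exists (ga_class A v k); rewrite Phi_funE.
have -> : psi bM v = iter k transferCZ f.
  by apply: CZ_fun_inj; rewrite iter_transferCZ fE.
by rewrite -iterLE (iter_cancel k LK).
Qed.

(** Forward, L_*^{-1} preserves positive classes. Backward, if the image of [v,m] is [f] with f >=
    0, then psi v ~ L^m f, so the functions agree after k more transfers and v A^k >= 0. *)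
Let Phi_fun_pos (x : GA A) : GA_pos x <-> DG_pos (Phi_fun x).
Proof.
split=> [[v [m [-> [k v0]]]]|].
  rewrite Phi_funE (psi_shift m k).
  have : DG_pos (cl (psi bM (v *m A ^+ k))).
    by exists (psi bM (v *m A ^+ k)); split=> //; apply/psi_fun_ge0.
  by elim: (m + k)%N => [//|j IH] /IH; rewrite iterS; exact: Linv_pos.
have [v [m ->]] := ga_class_surj x; rewrite Phi_funE => -[f [f0 fE]].
exists v, m; split=> //.
have /dg_classP[k e] : cl (psi bM v) = cl (iter m transferCZ f).
  by rewrite -iterLE -fE (iter_cancel m LinvK).
exists k; apply/psi_fun_ge0 => y.
rewrite -(iter_transfer_psi tau_pm bM sigma_tau).
have -> : iter k L (psi_fun b v) = iter (k + m) L f.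
  by rewrite iterD -(iter_transferCZ m f) -e.
exact: transfer_ge0.
Qed.

Lemma dimension_iso : exists Phi : {additive GA A -> DG sigma},
  [/\ (forall (v : 'rV[int]_q) (k : nat),
         Phi (ga_class A v k) = iter k Linv (cl (psi bM v))),
      bijective Phi,
      (forall x : GA A, GA_pos x <-> DG_pos (Phi x))
    & (forall x : GA A, Phi (ga_shift x) = Lstar (Phi x))].
Proof.
have [Phi PhiE] := additive_of_morph Phi_funD; exists Phi; split.
- by move=> v k; rewrite PhiE.
- have /choice[Psi PsiK] := Phi_fun_surj.
  exists Psi => x; last by rewrite PhiE.
  by apply: Phi_fun_inj; rewrite PsiK PhiE.
- by move=> x; rewrite PhiE; exact: Phi_fun_pos.
- move=> x; rewrite !PhiE; have [v [k ->]] := ga_class_surj x.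
  rewrite ga_shiftE !Phi_funE [in RHS](psi_shift k 1) addn1 iterS LinvK.
  by rewrite expr1.
Qed.

End Isomorphism.
End MarkovDimensionGroup.

Theorem proposition8p4 (R : realType) (tau : R -> R)
    (n : nat) (a : nat -> R)
    (tau_pm : piecewise_monotonic tau n a)
    (a_max : maximal_partition tau n a)
    (sigma : disconnection (gen_orbit tau (partition_points n a)) ->
             disconnection (gen_orbit tau (partition_points n a)))
    (sigma_tau : associated_map tau sigma)
    (q : nat) (b : nat -> R)
    (b_markov : markov_partition tau (partition_points n a) q b) :
  exists Lstar Linv : {additive DG sigma -> DG sigma},
    [/\ is_transfer_star Lstar, cancel Lstar Linv, cancel Linv Lstar &
      exists Phi : {additive GA (incidence sigma q b) -> DG sigma},
        [/\ (forall (v : 'rV[int]_q) (k : nat),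
               Phi (ga_class (incidence sigma q b) v k) =
               iter k Linv (dg_class sigma (psi b_markov v))),
            bijective Phi,
            (forall x, GA_pos x <-> DG_pos (Phi x))
          & (forall x, Phi (ga_shift x) = Lstar (Phi x))]].
Proof.
have [Lstar LE] := transfer_star_exists tau_pm b_markov sigma_tau.
have [Linv [LK LinvK Linv_pos]] := transfer_star_inverse LE.
exists Lstar, Linv; split=> //; last exact: dimension_iso LE LK LinvK Linv_pos.
by move=> f; exists (transferCZ tau_pm b_markov sigma_tau f); split.
Qed.
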